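(* Let $(E,e)$ be a unital operator system and let $\delta\ge0$. Then the set $\mathcal V_0^\delta(E):=\coprod_{n\ge1}\mathcal V_0^\delta(E,n)/_\sim$ is the direct limit $\varinjlim\mathcal V_0^\delta(E,n)$ of the direct system of sets $(\mathcal V_0^\delta(E,n),\imath_{nm})$ with connecting maps, for $m\ge n$, $$\imath_{nm}:\mathcal V_0^\delta(E,n)\to\mathcal V_0^\delta(E,m),\qquad [x]_n\mapsto[x\oplus e_{m-n}]_m .$$ Moreover, $\mathcal V_0^\delta(E)$ is a semigroup when equipped with the direct sum $[x]+[x']=[x\oplus x']$ and identity element $0=[e]$.
   Context: A unital operator system $(E,e)$ is a matrix-ordered $*$-vector space $E$ equipped with an Archimedean order unit $e$; $e_n$ denotes the diagonal matrix in $M_n(E)$ with entries $e$. For a linear map $\phi:E\to F$, $\phi^{(n)}:M_n(E)\to M_n(F)$ is $[x_{ij}]\mapsto[\phi(x_{ij})]$. ''cp'' means completely positive and ''ucp'' means unital completely positive. A dilation of a ucp map $\phi:E\to B(\mathcal H)$ is a ucp map $\psi:E\to B(\mathcal K)$ with $\mathcal K\supseteq\mathcal H$ a Hilbert space and $P_{\mathcal H}\psi(x)|_{\mathcal H}=\phi(x)$ for all $x\in E$. The ucp map $\phi$ is maximal if every dilation of $\phi$ is obtained by attaching a direct summand. A non-zero cp map $\phi:E\to B(\mathcal H)$ is pure if the only cp maps $\psi$ with $0\le\psi\le\phi$ are scalar multiples of $\phi$. For $\delta>0$, an element $x\in M_n(E)$ is $\delta$-singular if for all $s\in(0,\delta)$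 there exists $g>0$ such that for all pure and maximal ucp maps $\phi:E\to B(\mathcal H)$ $$\left|\phi^{(2n)}\left(s\cdot e_{2n}+\begin{pmatrix}0&x\\ x^*&0\end{pmatrix}\right)\right|\ge g\cdot \mathrm{id}_{\mathcal H}^{\oplus 2n},\qquad |T|=(T^*T)^{1/2}.$$ For $\delta=0$, $x$ is $0$-singular if there is $g>0$ such that this inequality holds with $s=0$ for all pure and maximal ucp maps $\phi$. $H^\delta(E,n)$ denotes the set of $\delta$-singular self-adjoint elements of $M_n(E)$. For $x,x'\in H^\delta(E,n)$ write $x\sim_n x'$ if there exists $\tilde x\in H^\delta(C([0,1])\otimes E,n)$ with $\tilde x(0)=x$ and $\tilde x(1)=x'$; here $C([0,1])\otimes E$ is the operator system tensor product with unit $1\otimes e$, realized inside $C([0,1])\otimes C^*_{\mathrm{env}}(E)$ (with $C^*_{\mathrm{env}}(E)$ the $C^*$-envelope of $E$), so that its elements are viewed as continuous functions on $[0,1]$. The class of $x$ is $[x]_n$, and $\mathcal V_0^\delta(E,n)=H^\delta(E,n)/_{\sim_n}$. For $x\in H^\delta(E,n)$ and $x'\in H^\delta(E,n')$ write $x\sim x'$ if there exists $k\ge n,n'$ such that $x\oplus e_{k-n}\sim_k x'\oplus e_{k-n'}$ in $H^\delta(E,k)$. The class of $x$ under $\sim$ is denoted $[x]$, and $\mathcal V_0^\delta(E)$ is the set of all these classes.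
   Formalization: The formal theorem assumes δ ≤ 1 in addition to δ ≥ 0: for δ > 1 and E nonzero, e is not δ-singular (at s = 1 the shifted unit is not bounded below), so the connecting maps and the identity [e] are undefined. *)

(* Defs.v *)
From HB Require Import structures.
From mathcomp Require Import all_boot all_order all_algebra sesquilinear.
From mathcomp.real_closed Require Import complex.
From mathcomp Require Import all_classical all_reals all_analysis.

Set Implicit Arguments.
Unset Strict Implicit.
Unset Printing Implicit Defensive.

Import Order.TTheory GRing.Theory Num.Theory.
Import numFieldNormedType.Exports.

Local Open Scope classical_set_scope.
Local Open Scope ring_scope.

Local Notation "x %:C" := (real_complex _ x) : ring_scope.

(* [{dot U for Num.conj}] is linear in its first argument. *)
Definition dot_norm (R : realType) (U : lmodType R[i])
    (d : {dot U for Num.conj}) (u : U) : R := Num.sqrt (complex.Re (d u u)).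

Record hilbert (R : realType) := Hilbert {
  hcar :> lmodType R[i];
  hdot : {dot hcar for Num.conj};
  hcomplete : forall u : nat -> hcar,
    (forall eps : R, 0 < eps -> exists N : nat, forall m n,
       (N <= m)%N -> (N <= n)%N -> dot_norm hdot (u m - u n) < eps) ->
    exists l : hcar, forall eps : R, 0 < eps -> exists N : nat, forall n,
       (N <= n)%N -> dot_norm hdot (u n - l) < eps }.

Definition hnorm (R : realType) (H : hilbert R) (h : H) : R :=
  dot_norm (hdot H) h.

Section Operators.
Context {R : realType}.
Implicit Types H K : hilbert R.

Definition bounded_op H K (T : H -> K) : Prop :=
  linear T /\ exists M : R, forall h, hnorm (T h) <= M * hnorm h.

Definition is_adjoint H K (T : H -> K) (S : K -> H) : Prop :=
  bounded_op S /\ forall h k, hdot K (T h) k = hdot H h (S k).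

Definition op_ge0 H (T : H -> H) : Prop := forall h, 0 <= hdot H (T h) h.

Definition op_ge H (T : H -> H) (g : R) : Prop :=
  op_ge0 (fun h => T h - g%:C *: h).

(* [A] is [|T|], the (unique) positive square root of [T^* T]. *)
Definition is_absop H (T A : H -> H) : Prop :=
  [/\ bounded_op A, op_ge0 A &
      exists2 S : H -> H, is_adjoint T S & forall h, A (A h) = S (T h)].

Definition isometric H K (V : H -> K) : Prop :=
  linear V /\ forall h h', hdot K (V h) (V h') = hdot H h h'.

End Operators.

Section DirectPower.
Context {R : realType} (H : hilbert R) (n : nat).
Local Notation Hn := {ffun 'I_n -> H}.

Definition power_dot (f g : Hn) : R[i] := \sum_i hdot H (f i) (g i).

Fact power_dot_bilinear :
  bilinear_for ( *%R : GRing.Scale.law _ _)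
    ((Num.conj \; *%R) : GRing.Scale.law _ _) power_dot.
Proof.
split=> [g a f f'|f a g g']; rewrite /applyr /power_dot /=.
- rewrite mulr_sumr -big_split /=; apply: eq_bigr => i _.
  by rewrite !ffunE linearPl.
- rewrite mulr_sumr -big_split /=; apply: eq_bigr => i _.
  by rewrite !ffunE linearPr.
Qed.

HB.instance Definition _ :=
  bilinear_isBilinear.Build _ _ _ _ _ _ power_dot power_dot_bilinear.

Fact power_dot_herm (f g : Hn) :
  power_dot f g = (-1) ^+ false * Num.conj (power_dot g f).
Proof.
rewrite expr0 mul1r rmorph_sum; apply: eq_bigr => i _ /=.
by rewrite hermC /= mul1r.
Qed.

HB.instance Definition _ :=
  isHermitianSesquilinear.Build _ _ _ _ power_dot power_dot_herm.

Fact power_dot_gt0 (f : Hn) : f != 0 -> 0 < power_dot f f.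
Proof.
move=> f0; rewrite lt_neqAle eq_sym sumr_ge0 ?andbT => [|i _]; last exact: dnorm_ge0.
apply: contraNneq f0 => /eqP; rewrite psumr_eq0 => [/allP f0|i _]; last exact: dnorm_ge0.
apply/eqP/ffunP => i; rewrite ffunE; apply/eqP.
by rewrite -(dnorm_eq0 (hdot H)); apply: f0; rewrite mem_index_enum.
Qed.

HB.instance Definition _ := isDotProduct.Build _ _ power_dot power_dot_gt0.

End DirectPower.

Section DirectPowerHilbert.
Context {R : realType}.

Lemma dot_norm_sqr (U : lmodType R[i]) (d : {dot U for Num.conj}) u :
  (dot_norm d u ^+ 2)%:C = d u u.
Proof.
have := dnorm_ge0 d u; rewrite /dot_norm; case: (d u u) => a b.
rewrite lecE /= => /andP[/eqP -> a0].
by rewrite sqr_sqrtr.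
Qed.

Lemma dot_norm_ge0 (U : lmodType R[i]) (d : {dot U for Num.conj}) u :
  0 <= dot_norm d u.
Proof. exact: sqrtr_ge0. Qed.

Lemma power_norm_sqr (H : hilbert R) n (f : {ffun 'I_n -> H}) :
  dot_norm (@power_dot R H n : {dot _ for Num.conj}) f ^+ 2 = \sum_i hnorm (f i) ^+ 2.
Proof.
have inj : injective (fun x : R => x%:C) by move=> x y [].
apply: inj; rewrite /= dot_norm_sqr rmorph_sum; apply: eq_bigr => i _.
by rewrite /= /hnorm dot_norm_sqr.
Qed.

Fact power_complete (H : hilbert R) n (u : nat -> {ffun 'I_n -> H}) :
  (forall eps : R, 0 < eps -> exists N : nat, forall p q,
     (N <= p)%N -> (N <= q)%N ->
     dot_norm (@power_dot R H n : {dot _ for Num.conj}) (u p - u q) < eps) ->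
  exists l, forall eps : R, 0 < eps -> exists N : nat, forall p,
     (N <= p)%N ->
     dot_norm (@power_dot R H n : {dot _ for Num.conj}) (u p - l) < eps.
Proof.
move=> cu.
have /choice[l lP] i : exists l : H, forall eps : R, 0 < eps ->
    exists N : nat, forall p, (N <= p)%N -> hnorm (u p i - l) < eps.
  apply: hcomplete => eps eps0; have [N NP] := cu _ eps0.
  exists N => p q Np Nq; apply: le_lt_trans (NP _ _ Np Nq).
  rewrite -(@ler_pXn2r _ 2) ?nnegrE ?dot_norm_ge0 //.
  rewrite power_norm_sqr (bigD1 i) //= !ffunE lerDl.
  by apply: sumr_ge0 => j _; exact: sqr_ge0.
exists [ffun i => l i] => eps eps0.
have e0 : 0 < eps / n.+1%:R by rewrite divr_gt0.
have /choice[N NP] i := lP i _ e0.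
exists (\max_i N i) => p Np.
rewrite -(@ltr_pXn2r _ 2) ?nnegrE ?dot_norm_ge0 ?(ltW eps0) //.
rewrite power_norm_sqr.
apply: (@le_lt_trans _ _ (\sum_(i < n) (eps / n.+1%:R) ^+ 2)).
  apply: ler_sum => i _; rewrite ler_pXn2r ?nnegrE ?dot_norm_ge0 ?(ltW e0) //.
  rewrite !ffunE; apply/ltW/NP/leq_trans/Np; exact: leq_bigmax.
rewrite sumr_const card_ord -[_ *+ n]mulr_natr expr_div_n -mulrA.
rewrite gtr_pMr ?exprn_gt0 // mulrC ltr_pdivrMr ?mul1r ?exprn_gt0 //.
by rewrite -natrX ltr_nat (@leq_trans n.+1) // expnS leq_pmulr.
Qed.

Definition hpower (H : hilbert R) n : hilbert R :=
  @Hilbert R {ffun 'I_n -> H} (@power_dot R H n) (@power_complete H n).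

End DirectPowerHilbert.

Section MatrixOps.
Context {R : realType} (V : lmodType R[i]).

Definition mxstar (star : V -> V) m n (x : 'M[V]_(m, n)) : 'M[V]_(n, m) :=
  (map_mx star x)^T.

(* a^* x a for a scalar matrix a *)
Definition mxcongr m n (a : 'M[R[i]]_(n, m)) (x : 'M[V]_n) : 'M[V]_m :=
  \matrix_(i, j) \sum_k \sum_l (Num.conj (a k i) * a l j) *: x k l.

Definition mxscale m n (z : R[i]) (x : 'M[V]_(m, n)) : 'M[V]_(m, n) :=
  map_mx ( *:%R z) x.

End MatrixOps.

Record opsys (R : realType) := OpSys {
  ocar :> lmodType R[i];
  ostar : ocar -> ocar;
  ounit : ocar;
  opos : forall n, set 'M[ocar]_n;
  ostarK : involutive ostar;
  ostarP : forall a x y, ostar (a *: x + y) = Num.conj a *: ostar x + ostar y;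
  ounit_sa : ostar ounit = ounit;
  opos_sa : forall n (x : 'M[ocar]_n), opos x -> mxstar ostar x = x;
  oposD : forall n (x y : 'M[ocar]_n), opos x -> opos y -> opos (x + y);
  oposZ : forall n (r : R) (x : 'M[ocar]_n), 0 <= r -> opos x -> opos (mxscale r%:C x);
  opos_proper : forall n (x : 'M[ocar]_n), opos x -> opos (- x) -> x = 0;
  opos_congr : forall n m (a : 'M[R[i]]_(n, m)) (x : 'M[ocar]_n),
    opos x -> opos (mxcongr a x);
  ounit_order : forall n (x : 'M[ocar]_n), mxstar ostar x = x ->
    exists2 r : R, 0 < r & opos (mxscale r%:C ounit%:M + x);
  ounit_archimedean : forall n (x : 'M[ocar]_n), mxstar ostar x = x ->
    (forall r : R, 0 < r -> opos (mxscale r%:C ounit%:M + x)) -> opos x }.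

Arguments ostar {R _}.
Arguments ounit {R}.
Arguments opos {R} _ {n}.

Section OpsysTheory.
Context {R : realType} (E : opsys R).
Implicit Types (x y : E) (n : nat).

Lemma ostarD x y : ostar (x + y) = ostar x + ostar y.
Proof. by have := ostarP 1 x y; rewrite rmorph1 !scale1r. Qed.

Lemma ostar0 : ostar (0 : E) = 0.
Proof. by apply: (addrI (ostar 0)); rewrite -ostarD !addr0. Qed.

Lemma ostarZ a x : ostar (a *: x) = Num.conj a *: ostar x.
Proof. by have := ostarP a x 0; rewrite ostar0 !addr0. Qed.

Lemma mxscaleD n a b (x : 'M[E]_n) :
  mxscale (a + b) x = mxscale a x + mxscale b x.
Proof. by apply/matrixP=> i j; rewrite !mxE scalerDl. Qed.

Lemma mxstarE n (x : 'M[E]_n) i j : mxstar ostar x i j = ostar (x j i).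
Proof. by rewrite !mxE. Qed.

Lemma mxstarD n (x y : 'M[E]_n) :
  mxstar ostar (x + y) = mxstar ostar x + mxstar ostar y.
Proof. by apply/matrixP=> i j; rewrite !mxE ostarD. Qed.

Lemma mxstarK n (x : 'M[E]_n) : mxstar ostar (mxstar ostar x) = x.
Proof. by apply/matrixP=> i j; rewrite !mxE ostarK. Qed.

Lemma opos_unit n : opos E (ounit E)%:M (n := n).
Proof.
have s0 : mxstar ostar (0 : 'M[E]_n) = 0.
  by apply/matrixP=> i j; rewrite !mxE ostar0.
have [r r0 pr] := ounit_order s0.
have ri : 0 <= r^-1 by rewrite invr_ge0 ltW.
have := oposZ ri pr; congr (opos _ _).
apply/matrixP=> i j; rewrite !mxE addr0 scalerA -rmorphM /= mulVf ?lt0r_neq0 //.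
by rewrite scale1r.
Qed.

Lemma opos_real_bound n (A : 'M[E]_n) (B : R) : mxstar ostar A = A -> 0 < B ->
  exists2 r : R, 0 < r & forall c : R, `|c| <= B ->
    opos E (mxscale r%:C (ounit E)%:M + mxscale c%:C A).
Proof.
move=> sA B0.
have sNA : mxstar ostar (- A) = - A.
  apply: (addrI (mxstar ostar A)); rewrite -mxstarD subrr sA subrr.
  by apply/matrixP=> i j; rewrite !mxE ostar0.
have [r r0 pr] := ounit_order sA; have [r' r'0 pr'] := ounit_order sNA.
exists (B * (r + r')) => [|c cB]; first by rewrite mulr_gt0 ?addr_gt0.
have [c0|c0] := leP 0 c.
- rewrite ger0_norm // in cB.
  have k0 : 0 <= B * (r + r') - c * r.
    by rewrite subr_ge0 ler_pM ?ler_wpDr // ltW.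
  have := oposD (oposZ c0 pr) (oposZ k0 (opos_unit n)); congr (opos _ _).
  apply/matrixP=> i j; rewrite !mxE scalerDr addrAC scalerA -scalerDl.
  by rewrite -rmorphM -rmorphD /= [X in X%:C]addrC subrK.
- rewrite ltr0_norm // in cB.
  have c0' : 0 <= - c by rewrite oppr_ge0 ltW.
  have k0 : 0 <= B * (r + r') - - c * r'.
    by rewrite subr_ge0 ler_pM ?ler_wpDl // ltW.
  have := oposD (oposZ c0' pr') (oposZ k0 (opos_unit n)); congr (opos _ _).
  apply/matrixP=> i j; rewrite !mxE scalerDr addrAC scalerA -scalerDl.
  by rewrite -rmorphM -rmorphD /= [X in X%:C]addrC subrK rmorphN scaleNr scalerN opprK.
Qed.

Lemma opos_elem_bound n (X : 'M[E]_n) (B : R) : 0 < B ->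
  exists2 r : R, 0 < r & forall z : R[i], `|z| <= B%:C ->
    opos E (mxscale r%:C (ounit E)%:M +
            (mxscale z X + mxstar ostar (mxscale z X))).
Proof.
move=> B0; set Y := mxscale 'i%C X.
have sX : mxstar ostar (X + mxstar ostar X) = X + mxstar ostar X.
  by rewrite mxstarD mxstarK addrC.
have sY : mxstar ostar (Y + mxstar ostar Y) = Y + mxstar ostar Y.
  by rewrite mxstarD mxstarK addrC.
have [r r0 pr] := opos_real_bound sX B0; have [r' r'0 pr'] := opos_real_bound sY B0.
exists (r + r') => [|z]; first exact: addr_gt0.
case: z => a b; rewrite normc_def lecR => zB.
have aB : `|a| <= B.
  by apply: le_trans zB; rewrite -sqrtr_sqr ler_wsqrtr // lerDl sqr_ge0.
have bB : `|b| <= B.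
  by apply: le_trans zB; rewrite -[`|b|]sqrtr_sqr ler_wsqrtr // lerDr sqr_ge0.
have := oposD (pr _ aB) (pr' _ bB); congr (opos _ _).
rewrite rmorphD mxscaleD -!addrA; congr (_ + _).
rewrite addrCA; congr (_ + _); apply/matrixP=> i j; rewrite !mxE.
have -> : Complex a b = a%:C + b%:C * 'i%C by simpc.
rewrite !ostarZ rmorphD rmorphM /= !scalerDl !scalerDr !scalerA.
have cR (c : R) : Num.conj (c%:C : R[i]) = c%:C.
  by rewrite -[LHS]/(Complex c (- 0)) oppr0.
by rewrite !cR addrACA.
Qed.

End OpsysTheory.

Section CompletelyPositive.
Context {R : realType} (E : opsys R).
Implicit Types H K : hilbert R.

(* phi^(n)(x), as an operator on H^n *)
Definition amp H (phi : E -> H -> H) n (x : 'M[E]_n) :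
    hpower H n -> hpower H n :=
  fun h : {ffun 'I_n -> H} => [ffun i => \sum_j phi (x i j) (h j)].

Definition is_cp H (phi : E -> H -> H) : Prop :=
  [/\ forall x, bounded_op (phi x),
      forall a x y h, phi (a *: x + y) h = a *: phi x h + phi y h &
      forall n (x : 'M[E]_n), opos E x -> op_ge0 (amp phi x)].

Definition is_ucp H (phi : E -> H -> H) : Prop :=
  is_cp phi /\ forall h, phi (ounit E) h = h.

Definition is_pure H (phi : E -> H -> H) : Prop :=
  [/\ is_cp phi, exists x h, phi x h != 0 &
      forall psi : E -> H -> H,
        is_cp psi -> is_cp (fun x h => phi x h - psi x h) ->
        exists c : R[i], forall x h, psi x h = c *: phi x h].

(* The inclusion of H in K is an isometry V; the last clause says that the
   orthogonal projection of [psi x (V h)] onto V(H) is [V (phi x h)]. *)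
Definition is_dilation H K (V : H -> K) (phi : E -> H -> H)
    (psi : E -> K -> K) : Prop :=
  [/\ isometric V, is_ucp psi &
      forall x h h', hdot K (psi x (V h) - V (phi x h)) (V h') = 0].

(* K is the orthogonal direct sum of V(H) and W(L), and psi = phi (+) rho. *)
Definition is_direct_summand H K (V : H -> K) (phi : E -> H -> H)
    (psi : E -> K -> K) : Prop :=
  exists (L : hilbert R) (W : L -> K) (rho : E -> L -> L),
  [/\ isometric W /\ is_ucp rho,
      forall h l, hdot K (V h) (W l) = 0,
      forall k, exists h l, k = V h + W l &
      forall x h l, psi x (V h + W l) = V (phi x h) + W (rho x l)].

Definition is_maximal H (phi : E -> H -> H) : Prop :=
  forall K (V : H -> K) (psi : E -> K -> K),
    is_dilation V phi psi -> is_direct_summand V phi psi.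

End CompletelyPositive.

Section Singular.
Context {R : realType} (E : opsys R).

Definition shifted (s : R) n (x : 'M[E]_n) : 'M[E]_(n + n) :=
  mxscale s%:C (ounit E)%:M + block_mx 0 x (mxstar ostar x) 0.

Definition unif_bounded_below n (y : 'M[E]_n) : Prop :=
  exists2 g : R, 0 < g &
  forall (H : hilbert R) (phi : E -> H -> H),
    is_ucp phi -> is_pure phi -> is_maximal phi ->
    exists2 A, is_absop (amp phi y) A & op_ge A g.

Definition delta_singular (delta : R) n (x : 'M[E]_n) : Prop :=
  if delta == 0 then unif_bounded_below (shifted 0 x)
  else forall s : R, 0 < s < delta -> unif_bounded_below (shifted s x).

(* H^delta(E, n), as a subset of M_n(E).  The unit lies in it when
   [0 <= delta <= 1]; for [delta > 1] the choice s = 1 makes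
   [shifted 1 (ounit E)%:M] singular in every unital representation. *)
Definition Hset (delta : R) n : set 'M[E]_n :=
  [set x | mxstar ostar x = x /\ delta_singular delta x].

Definition Hdelta (delta : R) n : Type := {x : 'M[E]_n | Hset delta x}.

End Singular.

(* The algebraic tensor product, whose elements are the E-valued functions
   t |-> \sum_i f_i(t) x_i with f_i in C([0,1]).  In
   C([0,1]) (x) C*env(E) = C([0,1], C*env(E)) a matrix is positive iff it is
   pointwise positive, and M_n(E) carries the order of M_n(C*env(E)), so the
   induced matrix order is the pointwise one. *)
Section Path.
Context {R : realType} (E : opsys R).

Definition unitI : Type := {t : R | t \in `[0, 1]}.

Definition tensor_set : set (unitI -> E) :=
  [set F | exists k (f : 'I_k -> R -> R[i]^o) (x : 'I_k -> E),
     (forall i, {within `[0, 1], continuous (f i)}) /\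
     forall t : unitI, F t = \sum_i (f i (sval t) : R[i]) *: x i].

Definition tensor_pred : {pred unitI -> E} := fun F => `[< tensor_set F >].

Fact tensor_submod : submod_closed tensor_pred.
Proof.
split=> [|a F G /asboolP[k [f [x [fc FE]]]] /asboolP[l [g [y [gc GE]]]]];
  apply/asboolP.
  exists 0%N, (fun _ _ => 0), (fun _ => 0); split=> [[]//|t].
  by rewrite big_ord0.
exists (k + l)%N,
  (fun i : 'I_(k + l) =>
     match fintype.split i with inl j => f j | inr j => g j end),
  (fun i : 'I_(k + l) =>
     match fintype.split i with inl j => a *: x j | inr j => y j end);
  split=> [i|t].
  by case: (fintype.split i) => j.
rewrite big_split_ord /= -[LHS]/(a *: F t + G t) FE GE scaler_sumr.
congr (_ + _); apply: eq_bigr => i _.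
- by rewrite (unsplitK (inl i)) !scalerA mulrC.
- by rewrite (unsplitK (inr i)).
Qed.

HB.instance Definition _ :=
  GRing.isSubmodClosed.Build R[i] (unitI -> E) tensor_pred tensor_submod.

Record tensor : Type :=
  Tensor { tensor_fun :> unitI -> E; _ : tensor_fun \in tensor_pred }.

HB.instance Definition _ := [isSub for tensor_fun].
HB.instance Definition _ := [Choice of tensor by <:].
HB.instance Definition _ := [SubChoice_isSubLmodule of tensor by <:].

Lemma tensorP (F : tensor) : tensor_set F.
Proof. by case: F => F /= /asboolP. Qed.

Lemma tensor_inj (F G : tensor) : (forall t, F t = G t) -> F = G.
Proof. by move=> FG; apply: val_inj; apply/funext. Qed.

Definition tensor_ev (t : unitI) (F : tensor) : E := F t.

Fact tensor_ev_linear t : linear (tensor_ev t).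
Proof. by []. Qed.

HB.instance Definition _ t :=
  GRing.isLinear.Build R[i] tensor E _ (tensor_ev t) (tensor_ev_linear t).

Fact tensor_star_proof (F : tensor) :
  (fun t => ostar (F t)) \in tensor_pred.
Proof.
apply/asboolP; have [k [f [x [fc FE]]]] := tensorP F.
exists k, (fun i t => Num.conj (f i t : R[i])), (ostar \o x); split=> [i|t].
  apply: (@within_continuous_comp _ _ R[i]^o _ (f i)
            (fun z : R[i]^o => Num.conj (z : R[i]))) => // z _.
  have FF : Filter (nbhs (z : R[i]^o)) by exact: nbhs_filter.
  apply/(@cvgrPdist_lt _ R[i]^o) => eps eps0.
  have zz : (w : R[i]^o) @[w --> (z : R[i]^o)] --> (z : R[i]^o) by exact: cvg_id.
  have := (@cvgrPdist_lt _ R[i]^o _ _ FF id z).1 zz _ eps0.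
  by apply: filterS => w; rewrite -rmorphB norm_conjC.
rewrite FE (big_morph _ (@ostarD _ E) (@ostar0 _ E)).
by apply: eq_bigr => i _; rewrite ostarZ.
Qed.

Definition tensor_star (F : tensor) : tensor := Tensor (tensor_star_proof F).

Fact tensor_simple_proof (f : R -> R[i]^o) (x : E) :
  {within `[0, 1], continuous f} ->
  (fun t : unitI => (f (sval t) : R[i]) *: x) \in tensor_pred.
Proof.
move=> fc; apply/asboolP; exists 1%N, (fun _ => f), (fun _ => x).
by split=> // t; rewrite big_ord1.
Qed.

Fact tensor_cst_proof (x : E) : (fun _ : unitI => x) \in tensor_pred.
Proof.
apply/asboolP; exists 1%N, (fun _ _ => 1), (fun _ => x); split=> [_|t].
  by move=> t; exact: cvg_cst.
by rewrite big_ord1 scale1r.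
Qed.

(* 1 (x) x *)
Definition tensor_cst (x : E) : tensor := Tensor (tensor_cst_proof x).

Definition tensor_mxev (t : unitI) n (F : 'M[tensor]_n) : 'M[E]_n :=
  map_mx (tensor_ev t) F.

Definition tensor_pos n : set 'M[tensor]_n :=
  [set F | forall t, opos E (tensor_mxev t F)].

Lemma tensor_mx_inj n (F G : 'M[tensor]_n) :
  (forall t, tensor_mxev t F = tensor_mxev t G) -> F = G.
Proof.
move=> FG; apply/matrixP=> i j; apply: tensor_inj => t.
by have /matrixP/(_ i j) := FG t; rewrite !mxE.
Qed.

Lemma tensor_mxevD t n (F G : 'M[tensor]_n) :
  tensor_mxev t (F + G) = tensor_mxev t F + tensor_mxev t G.
Proof. by apply/matrixP=> i j; rewrite !mxE. Qed.

Lemma tensor_mxevN t n (F : 'M[tensor]_n) :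
  tensor_mxev t (- F) = - tensor_mxev t F.
Proof. by apply/matrixP=> i j; rewrite !mxE linearN. Qed.

Lemma tensor_mxevZ t n z (F : 'M[tensor]_n) :
  tensor_mxev t (mxscale z F) = mxscale z (tensor_mxev t F).
Proof. by apply/matrixP=> i j; rewrite !mxE linearZ. Qed.

Lemma tensor_mxev_star t n (F : 'M[tensor]_n) :
  tensor_mxev t (mxstar tensor_star F) = mxstar ostar (tensor_mxev t F).
Proof. by apply/matrixP=> i j; rewrite !mxE. Qed.

Lemma tensor_mxev_unit t n :
  tensor_mxev t (tensor_cst (ounit E))%:M = (ounit E)%:M :> 'M[E]_n.
Proof. by apply/matrixP=> i j; rewrite !mxE; case: eqP; rewrite /= ?linear0. Qed.

Lemma tensor_mxev_congr t n m (a : 'M[R[i]]_(n, m)) (F : 'M[tensor]_n) :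
  tensor_mxev t (mxcongr a F) = mxcongr a (tensor_mxev t F).
Proof.
apply/matrixP=> i j; rewrite !mxE linear_sum; apply: eq_bigr => k _.
by rewrite linear_sum; apply: eq_bigr => l _; rewrite linearZ !mxE.
Qed.

Lemma continuous_unit_bounded (f : R -> R[i]^o) :
  {within `[0, 1], continuous f} ->
  exists2 B : R, 0 < B & forall t : unitI, `|f (sval t) : R[i]| <= B%:C.
Proof.
move=> fc; pose g t := complex.Re `|f t : R[i]|.
have gE t : `|f t : R[i]| = (g t)%:C by rewrite /g normc_def.
have gc : {within `[0, 1], continuous g}.
  apply: (@within_continuous_comp R[i]^o R R^o _ f
            (fun z : R[i]^o => complex.Re `|z : R[i]|)) => // z _.
  have FF : Filter (nbhs (z : R[i]^o)) by exact: nbhs_filter.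
  apply/(@cvgrPdist_lt _ R^o) => eps eps0.
  have zz : (w : R[i]^o) @[w --> (z : R[i]^o)] --> (z : R[i]^o) by exact: cvg_id.
  have eps0' : 0 < eps%:C :> R[i] by rewrite ltcR.
  have := (@cvgrPdist_lt _ R[i]^o _ _ FF id z).1 zz _ eps0'.
  apply: filterS => w zw.
  have := le_lt_trans (ler_dist_dist (z : R[i]) w) zw.
  have nE (x : R[i]) : `|x| = (complex.Re `|x|)%:C by rewrite normc_def.
  move: (nE z) (nE w); set a := complex.Re `|z|; set b := complex.Re `|w|.
  by move=> -> ->; rewrite -rmorphB normc_def /= expr0n /= addr0 sqrtr_sqr ltcR.
have [c c01 cmax] := EVT_max (ler01 : (0 : R) <= 1) gc.
exists (`|g c| + 1) => [|t]; first by rewrite ltr_wpDl.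
rewrite gE lecR; apply: le_trans (cmax _ (svalP t)) _.
by rewrite ler_wpDr // ler_norm.
Qed.

Definition boundable n (G : unitI -> 'M[E]_n) : Prop :=
  exists2 r : R, 0 < r & forall t,
    opos E (mxscale r%:C (ounit E)%:M + (G t + mxstar ostar (G t))).

Lemma boundableD n (G G' : unitI -> 'M[E]_n) :
  boundable G -> boundable G' -> boundable (fun t => G t + G' t).
Proof.
move=> [r r0 Pr] [r' r'0 Pr']; exists (r + r') => [|t]; first exact: addr_gt0.
have := oposD (Pr t) (Pr' t); congr (opos _ _).
by rewrite addrACA -mxscaleD -rmorphD mxstarD [in RHS]addrACA.
Qed.

Lemma boundable0 n : boundable (fun _ => 0 : 'M[E]_n).
Proof.
exists 1 => // t; have := opos_unit E n; congr (opos _ _).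
by apply/matrixP=> i j; rewrite !mxE scale1r ostar0 !addr0.
Qed.

Lemma boundable_sum n (I : finType) (G : I -> unitI -> 'M[E]_n) :
  (forall i, boundable (G i)) -> boundable (fun t => \sum_i G i t).
Proof.
move=> bG; suff: forall s : seq I, boundable (fun t => \sum_(i <- s) G i t).
  exact.
elim=> [|i s IH].
- rewrite (_ : (fun _ => _) = fun _ => 0); first exact: boundable0.
  by apply/funext => t; rewrite big_nil.
- rewrite (_ : (fun _ => _) = fun t => G i t + \sum_(j <- s) G j t).
    exact: boundableD.
  by apply/funext => t; rewrite big_cons.
Qed.

Lemma tensor_boundable n (F : 'M[tensor]_n) :
  boundable (fun t => tensor_mxev t F).
Proof.
pose D i j t : 'M[E]_n :=
  \matrix_(p, q) (if (p == i) && (q == j) then F i j t else 0).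
rewrite (_ : (fun _ => _) = fun t => \sum_i \sum_j D i j t); last first.
  apply/funext => t; apply/matrixP=> p q.
  rewrite summxE (bigD1 p) //= summxE (bigD1 q) //= !mxE !eqxx /=.
  rewrite big1 => [|j /negPf jq]; last by rewrite mxE eqxx eq_sym jq.
  rewrite big1 ?addr0 // => i /negPf ip; rewrite summxE big1 // => j _.
  by rewrite mxE eq_sym ip.
apply: boundable_sum => i; apply: boundable_sum => j.
have [k [f [x [fc FE]]]] := tensorP (F i j).
pose X l : 'M[E]_n := \matrix_(p, q) (if (p == i) && (q == j) then x l else 0).
rewrite (_ : D i j = fun t => \sum_l mxscale (f l (sval t)) (X l)); last first.
  apply/funext => t; apply/matrixP=> p q; rewrite mxE summxE FE.
  case: ifP => pq; last by rewrite big1 // => l _; rewrite !mxE pq scaler0.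
  by apply: eq_bigr => l _; rewrite !mxE pq.
apply: boundable_sum => l.
have [B B0 fB] := continuous_unit_bounded (fc l).
have [r r0 Pr] := opos_elem_bound (X l) B0.
by exists r => // t; apply: Pr.
Qed.

Fact tensor_order n (F : 'M[tensor]_n) : mxstar tensor_star F = F ->
  exists2 r : R, 0 < r &
    tensor_pos (mxscale r%:C (tensor_cst (ounit E))%:M + F).
Proof.
move=> sF; have [r r0 Pr] := tensor_boundable F.
exists (2^-1 * r) => [|t]; first by rewrite mulr_gt0 // invr_gt0.
have h0 : 0 <= 2^-1 :> R by rewrite invr_ge0.
have := oposZ h0 (Pr t); congr (opos _ _).
rewrite -tensor_mxev_star sF tensor_mxevD tensor_mxevZ tensor_mxev_unit.
apply/matrixP=> i j; rewrite !mxE scalerDr rmorphM -scalerA; congr (_ + _).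
by rewrite scalerDr -scalerDl -rmorphD -[2^-1]mul1r -splitr scale1r.
Qed.

Fact tensor_starP a (F G : tensor) :
  tensor_star (a *: F + G) = Num.conj a *: tensor_star F + tensor_star G.
Proof. by apply: tensor_inj => t; exact: ostarP. Qed.

Fact tensor_starK : involutive tensor_star.
Proof. by move=> F; apply: tensor_inj => t; exact: ostarK. Qed.

Fact tensor_unit_sa :
  tensor_star (tensor_cst (ounit E)) = tensor_cst (ounit E).
Proof. by apply: tensor_inj => t; exact: ounit_sa. Qed.

Fact tensor_pos_sa n (F : 'M[tensor]_n) :
  tensor_pos F -> mxstar tensor_star F = F.
Proof.
by move=> PF; apply: tensor_mx_inj => t; rewrite tensor_mxev_star opos_sa.
Qed.

Fact tensor_posD n (F G : 'M[tensor]_n) :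
  tensor_pos F -> tensor_pos G -> tensor_pos (F + G).
Proof. by move=> PF PG t; rewrite tensor_mxevD; exact: oposD. Qed.

Fact tensor_posZ n (r : R) (F : 'M[tensor]_n) :
  0 <= r -> tensor_pos F -> tensor_pos (mxscale r%:C F).
Proof. by move=> r0 PF t; rewrite tensor_mxevZ; exact: oposZ. Qed.

Fact tensor_pos_proper n (F : 'M[tensor]_n) :
  tensor_pos F -> tensor_pos (- F) -> F = 0.
Proof.
move=> PF PNF; apply: tensor_mx_inj => t; rewrite (_ : tensor_mxev t 0 = 0).
  by apply: opos_proper => //; rewrite -tensor_mxevN.
by apply/matrixP=> i j; rewrite !mxE.
Qed.

Fact tensor_pos_congr n m (a : 'M[R[i]]_(n, m)) (F : 'M[tensor]_n) :
  tensor_pos F -> tensor_pos (mxcongr a F).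
Proof. by move=> PF t; rewrite tensor_mxev_congr; exact: opos_congr. Qed.

Fact tensor_archimedean n (F : 'M[tensor]_n) : mxstar tensor_star F = F ->
  (forall r : R, 0 < r ->
     tensor_pos (mxscale r%:C (tensor_cst (ounit E))%:M + F)) -> tensor_pos F.
Proof.
move=> sF PF t; apply: ounit_archimedean; first by rewrite -tensor_mxev_star sF.
move=> r r0; have := PF r r0 t.
by rewrite tensor_mxevD tensor_mxevZ tensor_mxev_unit.
Qed.

Definition path_opsys : opsys R :=
  OpSys tensor_starK tensor_starP tensor_unit_sa tensor_pos_sa tensor_posD
    tensor_posZ tensor_pos_proper tensor_pos_congr tensor_order
    tensor_archimedean.

End Path.

Section Quotients.
Variables (T : Type) (r : T -> T -> Prop).

Definition quot : Type := {A : set T | exists x, A = [set y | r x y]}.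

Definition class_of (x : T) : quot :=
  exist _ [set y | r x y] (ex_intro _ x erefl).

End Quotients.

Definition psize : Type := {n : nat | (0 < n)%N}.
Definition nat_of_psize (n : psize) : nat := sval n.
Coercion nat_of_psize : psize >-> nat.

Definition psize1 : psize := exist _ 1%N isT.

Fact psize_add_proof (n m : psize) : (0 < n + m)%N.
Proof. by rewrite addn_gt0 (svalP n). Qed.

Definition psize_add (n m : psize) : psize := exist _ (n + m)%N (psize_add_proof n m).

Section DirectLimit.
Variable V : psize -> Type.
Variable iota : forall n m : psize, (n <= m)%N -> V n -> V m.

Definition direct_system : Prop :=
  (forall (n : psize) (le_nn : (n <= n)%N) (a : V n), iota le_nn a = a) /\
  (forall (n m p : psize) (le_nm : (n <= m)%N) (le_mp : (m <= p)%N)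
     (le_np : (n <= p)%N) (a : V n),
     iota le_mp (iota le_nm a) = iota le_np a).

Definition compatible (Z : Type) (g : forall n, V n -> Z) : Prop :=
  forall (n m : psize) (le_nm : (n <= m)%N) (a : V n), g m (iota le_nm a) = g n a.

Definition direct_limit (L : Type) (j : forall n, V n -> L) : Prop :=
  compatible j /\
  forall (Z : Type) (g : forall n, V n -> Z), compatible g ->
    exists! u : L -> Z, forall n (a : V n), u (j n a) = g n a.

End DirectLimit.

Section Invariant.
Context {R : realType} (E : opsys R) (delta : R).

Fact unitI0_proof : (0 : R) \in `[0, 1].
Proof. by rewrite in_itv /= lexx ler01. Qed.

Fact unitI1_proof : (1 : R) \in `[0, 1].
Proof. by rewrite in_itv /= lexx ler01. Qed.

Definition homotopic n (x x' : Hdelta E delta n) : Prop :=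
  exists F : Hdelta (path_opsys E) delta n,
    tensor_mxev (exist _ 0 unitI0_proof) (sval F) = sval x /\
    tensor_mxev (exist _ 1 unitI1_proof) (sval F) = sval x'.

Definition V0n (n : nat) : Type := quot (@homotopic n).

Definition V0n_class n (x : Hdelta E delta n) : V0n n := class_of (@homotopic n) x.

Definition dsum n m (x : 'M[E]_n) (y : 'M[E]_m) : 'M[E]_(n + m) :=
  block_mx x 0 0 y.

(* x (+) e_{m - n} *)
Definition stabilize n m (le_nm : (n <= m)%N) (x : 'M[E]_n) : 'M[E]_m :=
  castmx (subnKC le_nm, subnKC le_nm) (dsum x (ounit E)%:M).

Definition Hcoprod : Type := {n : psize & Hdelta E delta n}.

Definition stably_homotopic (x x' : Hcoprod) : Prop :=
  exists (k : nat) (le_k : (tag x <= k)%N) (le_k' : (tag x' <= k)%N)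
         (y y' : Hdelta E delta k),
    [/\ sval y = stabilize le_k (sval (tagged x)),
        sval y' = stabilize le_k' (sval (tagged x')) & homotopic y y'].

Definition V0 : Type := quot stably_homotopic.

Definition V0_class (n : psize) (x : Hdelta E delta n) : V0 :=
  class_of stably_homotopic
    (existT (fun n : psize => Hdelta E delta n) n x).

End Invariant.

Arguments V0_class {R E delta} n x.

(* Main.v *)
Require Import Defs.
From mathcomp Require Import all_boot all_order all_algebra.
From mathcomp.real_closed Require Import complex.
From mathcomp Require Import all_classical all_reals all_analysis.
From Stdlib Require Import RelationClasses.
From mathcomp Require Import perm sesquilinear ring lra.

Set Implicit Arguments.
Unset Strict Implicit.
Unset Printing Implicit Defensive.

Import Order.TTheory GRing.Theory Num.Theory.
Import numFieldNormedType.Exports.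

Local Open Scope classical_set_scope.
Local Open Scope ring_scope.

Local Notation "x %:C" := (real_complex _ x) : ring_scope.

(** The point is to know the pure maximal representations of the system of
    paths: they are exactly the maps [phi o ev_t], with [t] in [[0, 1]] and
    [phi] a pure maximal representation of [E]. Hence a path is singular if and
    only if its values are, with lower bounds uniform in [t] ([Hset_pathP]),
    and paths can be reversed, concatenated and conjugated by hand.

    In one direction ([path_rep_factor]) the point of the interval comes from
    purity. If [Phi] is pure on the path system, then [F |-> Phi (t F)] is
    completely positive and dominated by [Phi], so it is [c Phi] for a scalar
    [c] in [[0, 1]]. Then [Phi] kills [(t - c)^2 e], and positivity forces
    [Phi F] to depend on [F c] only ([cp_localize]): with [f c = 0] one has
    [|f| <= eps + K (t - c)^2] for every [eps], so [Phi] kills [|f| e], a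
    multiple of which majorizes the real part of [f x]. Conversely, a map dominated
    by [phi o ev_t], or a dilation of it restricted to the range of the smaller
    space, kills [(s - t)^2 e] and so is concentrated at [t] as well; purity
    and maximality of [phi o ev_t] follow from those of [phi] ([pure_ev],
    [maximal_ev]).

    The remaining analysis is stability of [|T| >= g] under conjugation by
    unitaries and under direct sums ([modulus_unitary], [modulus_glue]). It
    makes the singular elements stable under direct sums, and a Hadamard
    rotation shows that the unit is singular for [delta <= 1]: the shifted unit
    has eigenvalues [s + 1] and [s - 1].

    Up to homotopy the summands of a direct sum may be permuted: a transposition
    is a self-adjoint unitary scalar matrix, so it is joined to the identity by
    scalar unitaries, and conjugating by them preserves singularity with the
    same bounds ([joined_mxsub]). Therefore stable homotopy is compatible with
    direct sums, the sum of classes is commutative and associative, and adding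
    a unit changes nothing since that is how classes are stabilized. The direct
    limit property is formal: stably homotopic elements become homotopic at a
    common stage. *)

(** * Positive operators *)

Section PositiveOperators.
Context {R : realType}.
Implicit Types H K : hilbert R.

Lemma hdotDl H (a b c : H) : hdot H (a + b) c = hdot H a c + hdot H b c.
Proof. exact: linearDl. Qed.

Lemma hdotDr H (a b c : H) : hdot H a (b + c) = hdot H a b + hdot H a c.
Proof. exact: linearDr. Qed.

Lemma hdotNl H (a b : H) : hdot H (- a) b = - hdot H a b.
Proof. exact: linearNl. Qed.

Lemma hdotNr H (a b : H) : hdot H a (- b) = - hdot H a b.
Proof. exact: linearNr. Qed.

Lemma hdotZl H z (a b : H) : hdot H (z *: a) b = z * hdot H a b.
Proof. exact: linearZl_LR. Qed.

Lemma hdotZr H z (a b : H) : hdot H a (z *: b) = Num.conj z * hdot H a b.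
Proof. by rewrite linearZr_LR. Qed.

Lemma hdot0l H (a : H) : hdot H 0 a = 0.
Proof. exact: linear0l. Qed.

Lemma hdotC H (a b : H) : hdot H a b = Num.conj (hdot H b a).
Proof. by rewrite hermC /= mul1r. Qed.

Lemma hdot_ge0 H (a : H) : 0 <= hdot H a a.
Proof. exact: dnorm_ge0. Qed.

Lemma hdot_eq0 H (a : H) : hdot H a a = 0 -> a = 0.
Proof. by move/eqP; rewrite dnorm_eq0 => /eqP. Qed.

Lemma hnorm_sqr H (a : H) : (hnorm a ^+ 2)%:C = hdot H a a.
Proof. exact: dot_norm_sqr. Qed.

Lemma hnorm_ge0 H (a : H) : 0 <= hnorm a.
Proof. exact: dot_norm_ge0. Qed.

Lemma hnorm_isometric H K (V : H -> K) h : isometric V -> hnorm (V h) = hnorm h.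
Proof. by move=> [_ Vd]; rewrite /hnorm /dot_norm Vd. Qed.

Lemma conjcR (c : R) : Num.conj (c%:C : R[i]) = c%:C.
Proof. by rewrite -[LHS]/(Complex c (- 0)) oppr0. Qed.

Lemma conjci : Num.conj 'i%C = - 'i%C :> R[i].
Proof. by rewrite -[LHS]/(Complex (0 : R) (- 1)) -[RHS]/(Complex (- 0) (-1)) oppr0. Qed.

Lemma i_neq0 : ('i%C : R[i]) != 0.
Proof. by rewrite eq_complex /= oner_eq0 andbF. Qed.

Section LinearMaps.
Variables (H K : hilbert R) (T : H -> K).
Hypothesis Tl : linear T.

Lemma linear_fun0 : T 0 = 0.
Proof. by have := Tl (-1) 0 0; rewrite !scaleN1r oppr0 addr0 addNr. Qed.

Lemma linear_funD a b : T (a + b) = T a + T b.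
Proof. by have := Tl 1 a b; rewrite !scale1r. Qed.

Lemma linear_funZ c a : T (c *: a) = c *: T a.
Proof. by have := Tl c a 0; rewrite linear_fun0 !addr0. Qed.

Lemma linear_funN a : T (- a) = - T a.
Proof. by rewrite -scaleN1r linear_funZ scaleN1r. Qed.

Lemma linear_funB a b : T (a - b) = T a - T b.
Proof. by rewrite linear_funD linear_funN. Qed.

End LinearMaps.

(** Polarization: the sesquilinear form measuring the failure of symmetry
    vanishes on the diagonal, since a positive form is real there. *)
Lemma op_ge0_sym H (T : H -> H) : linear T -> op_ge0 T ->
  forall h k, hdot H (T h) k = hdot H h (T k).
Proof.
move=> Tl Tp h k; pose N a b := hdot H (T a) b - hdot H a (T b).
(* [N (h + k, h + k) = 0] and [N (i h + k, i h + k) = 0] give [N h k = 0]. *)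
have N0 a : N a a = 0.
  by rewrite /N (hdotC a) (CrealP _) ?subrr ?ger0_real.
have ND a b : N a b + N b a = 0.
  have := N0 (a + b); rewrite /N !linear_funD // !hdotDl !hdotDr => E.
  rewrite -[RHS]E; have := N0 a; have := N0 b; rewrite /N.
  move=> /eqP; rewrite subr_eq0 => /eqP ->; move=> /eqP.
  rewrite subr_eq0 => /eqP ->; ring.
have NZ : N ('i%C *: h) k = 'i%C * N h k.
  by rewrite /N linear_funZ // !hdotZl mulrBr.
have NZ' : N k ('i%C *: h) = - 'i%C * N k h.
  by rewrite /N linear_funZ // !hdotZr conjci mulrBr.
have := ND h k; have := ND ('i%C *: h) k; rewrite NZ NZ' => E1 E2.
have E3 : N h k - N k h = 0.
  by apply: (mulfI i_neq0); rewrite mulr0 mulrBr -[in RHS]E1 mulNr.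
have : N h k *+ 2 = (N h k + N k h) + (N h k - N k h) by rewrite addrACA subrr addr0.
rewrite E2 E3 addr0.
by move/eqP; rewrite mulrn_eq0 /= => /eqP/eqP; rewrite subr_eq0 => /eqP.
Qed.

(** The Cauchy-Schwarz inequality for the form of a positive operator [T],
    in its degenerate case: positivity at [h - s T h] for small [s] leaves no
    room for [T h]. *)
Lemma op_ge0_null H (T : H -> H) : linear T -> op_ge0 T ->
  forall h, hdot H (T h) h = 0 -> T h = 0.
Proof.
move=> Tl Tp h h0; apply: hdot_eq0.
set a := hdot H (T h) (T h); set d := hdot H (T (T h)) (T h).
have a0 : 0 <= a := hdot_ge0 _.
have d0 : 0 <= d := Tp _.
have d1 : 0 < d + 1 by rewrite ltr_wpDl.
(* With this s, [s d <= a], so [- 2 s a + s^2 d] is negative unless [a = 0]. *)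
pose s := a / (d + 1).
have s0 : 0 <= s by rewrite divr_ge0 // ltW.
have := Tp (h - s *: T h).
rewrite linear_funB // linear_funZ // !(hdotDl, hdotDr, hdotNl, hdotNr, hdotZl, hdotZr).
rewrite (CrealP (ger0_real s0)) h0 (op_ge0_sym Tl Tp (T h) h) -/a -/d => P.
have : 0 <= s * (s * d - a *+ 2).
  by apply: le_trans P _; rewrite le_eqVlt; apply/orP; left; apply/eqP; ring.
have sd : s * d <= a.
  by rewrite /s mulrAC -mulrA -[leRHS]mulr1 ler_wpM2l // ler_pdivrMr // mul1r lerDl.
have [a00|a00] := eqVneq a 0; first by [].
have s1 : 0 < s by rewrite divr_gt0 // lt_neqAle eq_sym a00.
rewrite pmulr_rge0 // subr_ge0 => P2; apply/eqP; rewrite eq_le a0 andbT.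
by have := le_trans P2 sd; rewrite mulr2n gerDl.
Qed.

End PositiveOperators.
(** * Completely positive maps *)

Section CompletelyPositiveMaps.
Context {R : realType} {E : opsys R} {H : hilbert R}.
Implicit Types (phi : E -> H -> H) (x y : E).

Lemma hdot_hpower n (f g : hpower H n) :
  hdot (hpower H n) f g = \sum_i hdot H (f i) (g i).
Proof. by []. Qed.

Section Linearity.
Variable phi : E -> H -> H.
Hypothesis cp : is_cp phi.

Lemma cp_linear x : linear (phi x).
Proof. by case: cp => /(_ x)[]. Qed.

Lemma cp0 h : phi 0 h = 0.
Proof.
case: cp => _ /(_ (-1) 0 0 h) + _.
by rewrite !scaleN1r oppr0 addr0 addNr.
Qed.

Lemma cpD x y h : phi (x + y) h = phi x h + phi y h.
Proof. by case: cp => _ /(_ 1 x y h) + _; rewrite !scale1r. Qed.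

Lemma cpZ c x h : phi (c *: x) h = c *: phi x h.
Proof. by case: cp => _ /(_ c x 0 h) + _; rewrite cp0 !addr0. Qed.

Lemma cpN x h : phi (- x) h = - phi x h.
Proof. by rewrite -scaleN1r cpZ scaleN1r. Qed.

Lemma cpB x y h : phi (x - y) h = phi x h - phi y h.
Proof. by rewrite cpD cpN. Qed.

Lemma cp_sum (I : finType) (F : I -> E) h :
  phi (\sum_i F i) h = \sum_i phi (F i) h.
Proof. by apply: (big_morph (phi^~ h)) => [x y|]; rewrite ?cpD ?cp0. Qed.

Lemma cp_ge0 x : opos E (x%:M : 'M[E]_1) -> op_ge0 (phi x).
Proof.
case: cp => _ _ pos /pos p h; have := p [ffun=> h].
by rewrite hdot_hpower big_ord1 !ffunE big_ord1 !ffunE mxE eqxx.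
Qed.

End Linearity.

(** Replacing [z] by [- z] gives the two-sided estimate
    [- r |z| e <= z x + (z x)^* <= r |z| e], homogeneous in [z]. *)
Lemma opos_real_part_bound x : exists2 r : R, 0 < r & forall z : R[i],
  opos E (((r%:C * `|z|) *: ounit E + (z *: x + ostar (z *: x)))%:M : 'M[E]_1).
Proof.
have [r r0 Pr] := opos_elem_bound (x%:M : 'M[E]_1) (ltr01 : (0 : R) < 1).
exists r => // z; have [->|z0] := eqVneq z 0.
  rewrite normr0 mulr0 !scale0r ostar0 !addr0.
  have := oposZ (lexx 0) (opos_unit E 1); congr (opos _ _).
  by apply/matrixP => i j; rewrite !mxE !ord1 eqxx scale0r.
have zn : `|z| = (complex.Re `|z|)%:C by rewrite normc_def.
have a0 : 0 < complex.Re `|z| by rewrite -ltcR -zn normr_gt0.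
have := Pr (z / `|z|); rewrite normrM normfV normr_id divff ?normr_eq0 //.
move=> /(_ (lexx _))/(oposZ (ltW a0)); congr (opos _ _).
apply/matrixP => i j; rewrite !mxE !ord1 eqxx /= -zn !scalerDr !scalerA mulrC.
congr (_ *: _ + _); rewrite !ostarZ scalerA rmorphM fmorphV /=.
rewrite (CrealP (normr_real z)) ![`|z| * _]mulrC -!mulrA mulVf ?normr_eq0 //.
by rewrite !mulr1.
Qed.

Lemma opos_unit1 : opos E ((ounit E)%:M : 'M[E]_1).
Proof. exact: opos_unit. Qed.

(** The real part of [x] is a difference of positive elements,
    [(r e + x^* + x) - r e]. *)
Lemma cp_sym_real phi x h k : is_cp phi ->
  hdot H (phi (x + ostar x) h) k = hdot H h (phi (x + ostar x) k).
Proof.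
move=> cp; have [r r0 Pr] := opos_real_part_bound x.
have := Pr 1; rewrite scale1r normr1 mulr1 => /(cp_ge0 cp) pos.
have sym := op_ge0_sym (cp_linear cp _) pos h k.
have sym1 := op_ge0_sym (cp_linear cp _) (cp_ge0 cp opos_unit1) h k.
move: sym; rewrite !(cpD cp (r%:C *: _)) !(cpZ cp) !hdotDl !hdotDr hdotZl hdotZr.
by rewrite conjcR sym1 => /addrI.
Qed.

(** By [cp_sym_real] for [x] and for [i x], whose real part is the imaginary
    part of [x] up to sign. *)
Lemma cp_adjoint phi x h k : is_cp phi ->
  hdot H (phi x h) k = hdot H h (phi (ostar x) k).
Proof.
move=> cp.
have cni : Num.conj (- 'i%C) = 'i%C :> R[i] by rewrite rmorphN /= conjci opprK.
have := cp_sym_real x h k cp; have := cp_sym_real ('i%C *: x) h k cp.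
rewrite ostarZ conjci !(cpD cp) !(cpZ cp) !hdotDl !hdotDr !hdotZl !hdotZr cni conjci.
rewrite !mulNr => E1 E2.
have /(mulfI i_neq0) E3 : 'i%C * (hdot H (phi x h) k - hdot H (phi (ostar x) h) k)
  = 'i%C * (hdot H h (phi (ostar x) k) - hdot H h (phi x k)).
  by rewrite !mulrBr E1 addrC.
move: (hdot H (phi x h) k) (hdot H (phi (ostar x) h) k) E2 E3 => a b E2 E3.
have : a *+ 2 = hdot H h (phi (ostar x) k) *+ 2.
  have -> : a *+ 2 = (a - b) + (a + b) by ring.
  by rewrite E2 E3; ring.
by move=> /eqP; rewrite -subr_eq0 -mulrnBl mulrn_eq0 /= subr_eq0 => /eqP.
Qed.

(** If [- p <= y <= p] then both [phi (p + y)] and [phi (p - y)] are positive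
    with a null vector [h], so both vanish there by [op_ge0_null]. *)
Lemma cp_null_majorant phi p y h : is_cp phi ->
  opos E ((p + y)%:M : 'M[E]_1) -> opos E ((p - y)%:M : 'M[E]_1) ->
  hdot H (phi p h) h = 0 -> phi y h = 0.
Proof.
move=> cp /(cp_ge0 cp) pos1 /(cp_ge0 cp) pos2 ph.
have := pos1 h; have := pos2 h.
rewrite !(cpD cp) (cpN cp) !hdotDl hdotNl ph !add0r oppr_ge0 => y1 y2.
have yh : hdot H (phi y h) h = 0 by apply/eqP; rewrite eq_le y1.
have e1 : phi (p + y) h = 0.
  apply: op_ge0_null => //; first exact: cp_linear.
  by rewrite (cpD cp) hdotDl ph yh addr0.
have e2 : phi (p - y) h = 0.
  apply: op_ge0_null => //; first exact: cp_linear.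
  by rewrite (cpB cp) hdotDl hdotNl ph yh subr0.
have : phi y h *+ 2 = 0.
  rewrite -[RHS](subrr (0 : H)) -{1}e1 -e2 !(cpD cp) (cpN cp) mulr2n.
  by rewrite opprD opprK addrACA subrr add0r.
by move=> /eqP; rewrite -scaler_nat scaler_eq0 pnatr_eq0 /= => /eqP.
Qed.

End CompletelyPositiveMaps.
(** * Representations of the path system *)

Section Composition.
Context {R : realType} {E E' : opsys R} {H : hilbert R}.
Variables (phi : E -> H -> H) (L : E' -> E).

Lemma amp_comp n (X : 'M[E']_n) h :
  amp (fun x => phi (L x)) X h = amp phi (map_mx L X) h.
Proof. by apply/ffunP => i; rewrite !ffunE; apply: eq_bigr => j _; rewrite mxE. Qed.

Lemma cp_comp : linear L ->
  (forall n (X : 'M[E']_n), opos E' X -> opos E (map_mx L X)) ->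
  is_cp phi -> is_cp (fun x => phi (L x)).
Proof.
move=> Ll Lp [bd lin pos]; split=> [x|a x y h|n X X0 h]; first exact: bd.
  by rewrite Ll lin.
by rewrite amp_comp; apply/pos/Lp.
Qed.

End Composition.

Section PathSystem.
Context {R : realType} {E : opsys R}.
Implicit Types (F G : tensor E) (t : @unitI R).

Lemma continuous_realC : continuous (fun u : R => u%:C : R[i]^o).
Proof.
move=> u; apply/(@cvgrPdist_lt _ R[i]^o) => eps eps0.
have epsE : eps = (complex.Re eps)%:C.
  by case: eps eps0 => a b; rewrite ltcE /= => /andP[/eqP -> _].
have e0 : 0 < complex.Re eps by rewrite -ltcR -epsE.
near=> v.
have uv : `|u - v| < complex.Re eps.
  by near: v; apply: (@cvgr_dist_lt _ R^o) => //; exact: cvg_id.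
by rewrite epsE -rmorphB normc_def /= expr0n /= addr0 sqrtr_sqr ltcR.
Unshelve. all: by end_near. Qed.

Lemma within_realC (f : R -> R) : continuous f ->
  {within `[0, 1], continuous (fun u => (f u)%:C : R[i]^o)}.
Proof.
move=> fc; apply: continuous_subspaceT => u.
apply: (@continuous_comp _ _ _ f (fun v : R => v%:C : R[i]^o)); first exact: fc.
exact: continuous_realC.
Qed.

Section Scaling.
Variable g : R -> R[i]^o.
Hypothesis gc : {within `[0, 1], continuous g}.

Lemma fscale_proof F : (fun t => (g (sval t) : R[i]) *: F t) \in @tensor_pred R E.
Proof.
have [k [f [x [fc FE]]]] := tensorP F; apply/asboolP.
exists k, (fun i u => (g u : R[i]) * (f i u : R[i])), x; split=> [i|t].
  by move=> u; apply: (@continuousM R[i]); [exact: gc|exact: fc].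
by rewrite FE scaler_sumr; apply: eq_bigr => i _; rewrite scalerA.
Qed.

Definition fscale F : tensor E := Tensor (fscale_proof F).

Lemma fscale_linear : linear fscale.
Proof.
move=> a F G; apply: tensor_inj => t.
rewrite -[LHS]/(_ *: (a *: F t + G t)) -[RHS]/(a *: (_ *: F t) + _ *: G t).
by rewrite scalerDr !scalerA mulrC.
Qed.

Lemma fscale_pos n (X : 'M[tensor E]_n) :
  (forall t, exists2 c : R, 0 <= c & (g (sval t) : R[i]) = c%:C) ->
  opos (path_opsys E) X -> opos (path_opsys E) (map_mx fscale X).
Proof.
move=> g0 X0 t; have [c c0 cE] := g0 t; have := oposZ c0 (X0 t).
by congr (opos _ _); apply/matrixP => i j; rewrite !mxE -cE.
Qed.

End Scaling.

Lemma tensor_cst_linear : linear (@tensor_cst R E).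
Proof. by move=> a x y; apply: tensor_inj. Qed.

Lemma tensor_cst_pos n (X : 'M[E]_n) :
  opos E X -> opos (path_opsys E) (map_mx (@tensor_cst R E) X).
Proof.
by move=> X0 t; have := X0; congr (opos _ _); apply/matrixP => i j; rewrite !mxE.
Qed.

Lemma tensor_ev_pos t n (X : 'M[tensor E]_n) :
  opos (path_opsys E) X -> opos E (map_mx (tensor_ev t) X).
Proof. by move=> /(_ t). Qed.

Lemma path_opos1P F : opos (path_opsys E) (F%:M : 'M[tensor E]_1) <->
  forall t, opos E ((F t)%:M : 'M[E]_1).
Proof.
have ev t : tensor_mxev t (F%:M : 'M[tensor E]_1) = (F t)%:M.
  by apply/matrixP => i j; rewrite !mxE !ord1 eqxx.
by split=> P t; [have := P t; rewrite ev|rewrite /= ev].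
Qed.

Definition funit (g : R -> R[i]^o) (gc : {within `[0, 1], continuous g}) : tensor E :=
  fscale gc (tensor_cst (ounit E)).

Fact sqdist_continuous t : continuous (fun u : R => (u - sval t) ^+ 2).
Proof.
move=> u; apply: (@continuous_comp _ _ _ (fun u => u - sval t) (fun u => u ^+ 2)).
  by apply: continuousB => //; exact: cst_continuous.
exact: exprn_continuous.
Qed.

(** The test element [(s - t)^2 e]: a representation killing it is concentrated
    at the parameter [t]. *)
Definition sqdist t : tensor E := funit (within_realC (@sqdist_continuous t)).

End PathSystem.
Section Localization.
Context {R : realType} {E : opsys R}.
Implicit Types (F G : tensor E) (t : @unitI R).

(** Near [t] the bound [eps] suffices by continuity; away from [t] a large
    multiple of the squared distance exceeds the maximum of [|f|]. *)
Lemma growth_bound (f : R -> R[i]^o) t : {within `[0, 1], continuous f} ->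
  f (sval t) = 0 -> forall eps : R, 0 < eps -> exists2 K : R, 0 <= K &
  forall s : unitI, `|f (sval s) : R[i]| <= (eps + K * (sval s - sval t) ^+ 2)%:C.
Proof.
move=> fc ft eps eps0; have [B B0 fB] := continuous_unit_bounded fc.
(* [B] bounds [|f|], and [|f| < eps] within distance [d] of [t]. *)
have /(_ (svalP t)) ct := (subspace_continuousP _ f).1 fc (sval t).
have FF : Filter (within (fun x : R => x \in `[0, 1]) (nbhs (sval t))) by exact: within_filter.
have eps0' : 0 < eps%:C :> R[i] by rewrite ltcR.
have := (@cvgrPdist_lt _ R[i]^o _ _ FF f (f (sval t))).1 ct _ eps0'.
move=> /nbhs_ballP[d d0 dP].
have dd : 0 < d ^+ 2 by rewrite exprn_gt0.
exists (B / d ^+ 2) => [|s]; first by rewrite divr_ge0 // ltW.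
have [st|st] := ltP `|sval t - sval s| d.
  have := dP (sval s) st (svalP s); rewrite ft sub0r normrN => /ltW/le_trans; apply.
  by rewrite lecR lerDl mulr_ge0 ?sqr_ge0 // divr_ge0 // ltW.
apply: le_trans (fB s) _; rewrite lecR ler_wpDl ?(ltW eps0) //.
rewrite mulrAC ler_pdivlMr // ler_pM2l // -(real_normK (num_real (sval s - _))) distrC.
by rewrite ler_pXn2r ?nnegrE ?(ltW d0).
Qed.

Lemma funit_pos (g : R -> R[i]^o) (gc : {within `[0, 1], continuous g}) :
  (forall t, exists2 c : R, 0 <= c & (g (sval t) : R[i]) = c%:C) ->
  opos (path_opsys E) ((@funit _ E _ gc)%:M : 'M[tensor E]_1).
Proof.
move=> g0; apply/path_opos1P => t; have [c c0 cE] := g0 t.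
have := oposZ c0 (opos_unit E 1); congr (opos _ _).
by apply/matrixP => i j; rewrite !mxE !ord1 eqxx -[RHS]/(g (sval t) *: _) cE.
Qed.

Lemma within_norm (f : R -> R[i]^o) : {within `[0, 1], continuous f} ->
  {within `[0, 1], continuous (fun u => `|f u : R[i]| : R[i]^o)}.
Proof.
move=> fc; apply: (@within_continuous_comp _ _ R[i]^o _ f
   (fun z : R[i]^o => `|z : R[i]| : R[i]^o)) => // z _.
exact: (@norm_continuous _ R[i]^o).
Qed.

Lemma within_sub_cst (f : R -> R[i]^o) (c : R[i]) : {within `[0, 1], continuous f} ->
  {within `[0, 1], continuous (fun u => (f u : R[i]) - c : R[i]^o)}.
Proof.
move=> fc u; apply: (@continuousB R[i] R[i]^o); first exact: fc.
exact: cst_continuous.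
Qed.

Section Localize.
Variables (H : hilbert R) (Phi : path_opsys E -> H -> H).
Variables (t : @unitI R) (h : H).
Hypothesis Phi_cp : is_cp Phi.
Hypothesis sq0 : hdot H (Phi (sqdist t) h) h = 0.

(** Since [|f|] is at most [eps + K (s - t)^2] for every [eps], the positive
    functional [F |-> <Phi(F) h, h>] kills [|f| e]. *)
Lemma localize_norm (f : R -> R[i]^o) (fc : {within `[0, 1], continuous f}) :
  f (sval t) = 0 -> hdot H (Phi (funit (within_norm fc)) h) h = 0.
Proof.
move=> ft; set P := funit _.
have P0 : 0 <= hdot H (Phi P h) h.
  apply: (cp_ge0 Phi_cp); apply: funit_pos => s.
  exists (complex.Re `|f (sval s) : R[i]|); last by rewrite normc_def.
  by rewrite -lecR; have := normr_ge0 (f (sval s) : R[i]); rewrite normc_def.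
have Pe (eps : R) : 0 < eps ->
    hdot H (Phi P h) h <= eps%:C * hdot H (Phi (tensor_cst (ounit E)) h) h.
  move=> eps0; have [K K0 fK] := growth_bound fc ft eps0.
  have := @cp_ge0 _ _ _ _ Phi_cp
    (eps%:C *: tensor_cst (ounit E) + K%:C *: sqdist t - P : tensor E) _ h.
  rewrite (cpB Phi_cp) (cpD Phi_cp) !(cpZ Phi_cp) hdotDl hdotNl hdotDl !hdotZl.
  rewrite sq0 mulr0 addr0 subr_ge0; apply.
  apply/path_opos1P => s; have fs := fK s.
  set N := complex.Re `|f (sval s) : R[i]|.
  have NE : `|f (sval s) : R[i]| = N%:C by rewrite /N normc_def.
  rewrite NE lecR -subr_ge0 in fs.
  have := oposZ fs (opos_unit E 1); congr (opos _ _).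
  apply/matrixP => i j; rewrite !mxE !ord1 eqxx !mulr1n.
  rewrite -[RHS]/(eps%:C *: ounit E + K%:C *: (((sval s - sval t) ^+ 2)%:C *: ounit E)
    - `|f (sval s) : R[i]| *: ounit E).
  by rewrite NE scalerA -scalerDl -scalerBl -rmorphM -rmorphD -rmorphB.
apply/eqP; rewrite eq_le P0 andbT.
set c := hdot H (Phi (tensor_cst _) h) h in Pe; set p := hdot H (Phi P h) h in P0 Pe *.
have c0 : 0 <= c.
  by apply: (cp_ge0 Phi_cp); apply/path_opos1P => s; exact: (opos_unit E 1).
have [pE cE] : p = (complex.Re p)%:C /\ c = (complex.Re c)%:C.
  by split; [move: p P0 {Pe}|move: c c0 {Pe}] => -[a b]; rewrite lecE /= => /andP[/eqP -> _].
(* The factor [c + 1] instead of [c] avoids a division by zero. *)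
rewrite pE lecR; apply/ler_addgt0Pl => e e0; rewrite addr0.
have c1 : 0 < complex.Re c + 1 by rewrite ltr_wpDl // -lecR -cE.
have := Pe (e / (complex.Re c + 1)) (divr_gt0 e0 c1).
rewrite pE [X in _ * X]cE -rmorphM lecR => /le_trans; apply.
by rewrite mulrAC -mulrA -[leRHS]mulr1 ler_pM2l // ler_pdivrMr // mul1r lerDl.
Qed.

(** Both the real part of [f x] and that of [i f x] are majorized by a multiple
    of [|f| e], hence killed at [h]; together they determine [f x]. *)
Lemma localize_simple (f : R -> R[i]^o) (fc : {within `[0, 1], continuous f}) x :
  f (sval t) = 0 -> Phi (fscale fc (tensor_cst x)) h = 0.
Proof.
move=> ft; set G := fscale _ _.
have [r r0 Pr] := opos_real_part_bound x.
pose P := r%:C *: funit (within_norm fc) : tensor E.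
have Ph : hdot H (Phi P h) h = 0.
  by rewrite (cpZ Phi_cp) hdotZl localize_norm ?mulr0.
have key (z : R[i]) : `|z| = 1 ->
    Phi (z *: G + tensor_star (z *: G) : tensor E) h = 0.
  move=> z1; apply: (cp_null_majorant Phi_cp _ _ Ph); apply/path_opos1P => s.
    have := Pr (z * f (sval s)); rewrite normrM z1 mul1r.
    by rewrite -!scalerA.
  have := Pr (- (z * f (sval s))); rewrite normrN normrM z1 mul1r.
  rewrite !scaleNr -scaleN1r ostarZ (rmorphN1 (Num.conj : {rmorphism R[i] -> R[i]})).
  by rewrite scaleN1r scaleN1r -opprD -!scalerA.
have n1 : `|1 : R[i]| = 1 by rewrite normr1.
have ni : `|'i%C : R[i]| = 1.
  by rewrite normc_def /= expr0n /= expr1n add0r sqrtr1.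
have E1 := key _ n1; have E2 := key _ ni.
have starZ a (F : tensor E) : tensor_star (a *: F) = Num.conj a *: tensor_star F.
  by apply: tensor_inj => s; exact: ostarZ.
move: E1 E2; rewrite !starZ rmorph1 !scale1r conjci !(cpD Phi_cp) !(cpZ Phi_cp).
rewrite scaleNr => E1 /eqP; rewrite -scalerBr scaler_eq0 (negPf i_neq0) subr_eq0 => /eqP E2.
move: E1; rewrite -E2 -mulr2n => /eqP.
by rewrite -scaler_nat scaler_eq0 pnatr_eq0 /= => /eqP.
Qed.

(** [F - F t] is a finite sum of simple tensors [(f - f t) x], to which
    [localize_simple] applies. *)
Lemma cp_localize F : Phi F h = Phi (tensor_cst (F t)) h.
Proof.
apply/eqP; rewrite -subr_eq0 -(cpB Phi_cp); apply/eqP.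
have [k [f [x [fc FE]]]] := tensorP F.
have -> : F - tensor_cst (F t) = \sum_i
    fscale (@within_sub_cst (f i) (f i (sval t)) (fc i)) (tensor_cst (x i)) :> tensor E.
  apply: tensor_inj => s.
  rewrite -[LHS]/(F s - F t) !FE -sumrB -[RHS]/(tensor_ev s _) linear_sum /=.
  by apply: eq_bigr => i _; rewrite -scalerBl.
rewrite (cp_sum Phi_cp) big1 // => i _.
by apply: localize_simple; rewrite subrr.
Qed.

End Localize.
End Localization.
Section PureRepresentations.
Context {R : realType} {E : opsys R}.
Implicit Types (F G : tensor E) (t : @unitI R) (H : hilbert R).

Lemma ucp_ev H (phi : E -> H -> H) t : is_ucp phi ->
  is_ucp (fun F : path_opsys E => phi (tensor_ev t F)).
Proof.
move=> [cp u]; split=> // .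
by apply: (@cp_comp _ _ (path_opsys E)) => //; exact: (@tensor_ev_pos R E t).
Qed.

Lemma ucp_cst H (Phi : path_opsys E -> H -> H) : is_ucp Phi ->
  is_ucp (fun x => Phi (tensor_cst x)).
Proof.
move=> [cp u]; split=> // .
by apply: (@cp_comp _ (path_opsys E)) => //;
  [exact: tensor_cst_linear|exact: tensor_cst_pos].
Qed.

Fact param_continuous : continuous (fun u : R => u).
Proof. by move=> u; exact: cvg_id. Qed.

Definition tmul : tensor E -> tensor E := fscale (within_realC param_continuous).

(** As the parameter lies between 0 and 1, both [F |-> Phi (t F)] and
    [F |-> Phi ((1 - t) F)] are completely positive, and purity applies. *)
Lemma pure_tmul H (Phi : path_opsys E -> H -> H) : is_pure Phi ->
  exists c : R[i], forall F h, Phi (tmul F) h = c *: Phi F h.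
Proof.
move=> [cp _ pure].
have cc : continuous (fun u : R => 1 - u).
  by move=> u; apply: continuousB => //; exact: cst_continuous.
have [||c cP] := pure (fun F h => Phi (tmul F) h).
- apply: (@cp_comp _ (path_opsys E) (path_opsys E) H Phi) => //.
    exact: fscale_linear.
  move=> n X; apply: fscale_pos => t; exists (sval t) => //.
  by have := svalP t; rewrite in_itv /= => /andP[].
- rewrite (_ : (fun _ _ => _) = fun F h => Phi (fscale (within_realC cc) F) h).
    apply: (@cp_comp _ (path_opsys E) (path_opsys E) H Phi) => //.
      exact: fscale_linear.
    move=> n X; apply: fscale_pos => t; exists (1 - sval t) => //.
    by have := svalP t; rewrite in_itv /= subr_ge0 => /andP[].
  apply/funext => F; apply/funext => h; rewrite -(cpB cp); congr (Phi _ h).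
  apply: tensor_inj => t.
  rewrite -[LHS]/(F t - (sval t)%:C *: F t) -[RHS]/((1 - sval t)%:C *: F t).
  by rewrite rmorphB rmorph1 scalerBl scale1r.
by exists c => F h; exact: cP.
Qed.

Lemma sqdistE t : sqdist t =
  tmul (tmul (tensor_cst (ounit E))) - (sval t *+ 2)%:C *: tmul (tensor_cst (ounit E))
  + (sval t ^+ 2)%:C *: tensor_cst (ounit E).
Proof.
apply: tensor_inj => s; set e := ounit E; set u := sval s.
rewrite -[LHS]/(((u - sval t) ^+ 2)%:C *: e).
rewrite -[RHS]/(u%:C *: (u%:C *: e) - (sval t *+ 2)%:C *: (u%:C *: e)
  + (sval t ^+ 2)%:C *: e).
rewrite !scalerA -scalerBl -scalerDl -!rmorphM -rmorphB -rmorphD /=.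
by congr (_%:C *: _); ring.
Qed.

(** The point is the scalar [c] of [pure_tmul]: it is [<Phi(t e) h, h>] for any
    unit vector [h], hence in [[0, 1]], and
    [Phi ((t - c)^2 e) = (c^2 - 2 c c + c^2) Phi e = 0]. *)
Lemma pure_path_ev H (Phi : path_opsys E -> H -> H) : is_ucp Phi -> is_pure Phi ->
  exists t, forall F h, Phi F h = Phi (tensor_cst (F t)) h.
Proof.
move=> [cp u] pu; have [c cP] := pure_tmul pu.
have [_ [F0 [h0 Fh0]] _] := pu.
have h00 : h0 != 0.
  by apply: contraNneq Fh0 => ->; rewrite (linear_fun0 (cp_linear cp _)).
have d0 : 0 < hdot H h0 h0 by rewrite lt_neqAle hdot_ge0 eq_sym dnorm_eq0 h00.
set e : tensor E := tensor_cst (ounit E).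
have ue h : Phi e h = h := u h.
have c0 : 0 <= c.
  rewrite -(pmulr_lge0 _ d0) -hdotZl -[in X in hdot _ X _](ue h0) -cP.
  apply: (cp_ge0 cp); apply/path_opos1P => s.
  have s0 : 0 <= sval s by have := svalP s; rewrite in_itv /= => /andP[].
  have := oposZ s0 (opos_unit E 1); congr (opos _ _).
  by apply/matrixP => i j; rewrite !mxE !ord1 eqxx.
have c1 : c <= 1.
  rewrite -subr_ge0 -(pmulr_lge0 _ d0) mulrBl mul1r -hdotZl -{1 3}(ue h0) -cP.
  rewrite -hdotNl -hdotDl -(cpB cp).
  apply: (cp_ge0 cp); apply/path_opos1P => s.
  have s0 : 0 <= 1 - sval s.
    by have := svalP s; rewrite in_itv /= subr_ge0 => /andP[].
  have := oposZ s0 (opos_unit E 1); congr (opos _ _).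
  apply/matrixP => i j; rewrite !mxE !ord1 eqxx /= !mulr1n.
  by rewrite rmorphB scalerBl rmorph1 scale1r.
have cE : c = (complex.Re c)%:C.
  by case: c c0 {c1 cP} => a b; rewrite lecE /= => /andP[/eqP -> _].
have ct : complex.Re c \in `[0, 1].
  by rewrite in_itv /=; move: c0 c1; rewrite cE !lecR => -> ->.
pose t : @unitI R := exist _ (complex.Re c) ct.
exists t => F h; apply: cp_localize => //.
rewrite sqdistE (cpD cp) (cpB cp) !(cpZ cp) !cP ue scalerA.
rewrite -[sval t]/(complex.Re c) rmorphMn rmorphXn /= -cE !scalerA -scalerBl -scalerDl.
rewrite (_ : _ + _ = 0) ?scale0r ?hdot0l //; ring.
Qed.

(** Purity and maximality descend from [Phi = phi o ev_t] to [phi] because maps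
    dominated by [phi] and dilations of [phi] can be composed with [ev_t]. *)
Lemma path_rep_factor H (Phi : path_opsys E -> H -> H) :
  is_ucp Phi -> is_pure Phi -> is_maximal Phi ->
  exists t (phi : E -> H -> H), [/\ is_ucp phi, is_pure phi, is_maximal phi &
    Phi = fun F => phi (tensor_ev t F)].
Proof.
move=> ucp pure max; have [t tP] := pure_path_ev ucp pure.
pose phi x h := Phi (tensor_cst x) h.
have PhiE : Phi = fun F => phi (tensor_ev t F).
  by apply/funext => F; apply/funext => h; exact: tP.
have uphi : is_ucp phi := ucp_cst ucp.
exists t, phi; split=> //.
- have [_ [F0 [h0 Fh0]] pureP] := pure; split; first by case: uphi.
    by exists (F0 t), h0; rewrite /phi -tP.
  move=> psi psicp subcp.
  have [||c cP] := pureP (fun F => psi (tensor_ev t F)).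
  + by apply: (@cp_comp _ _ (path_opsys E)) => //; exact: (@tensor_ev_pos R E t).
  + rewrite PhiE.
    apply: (@cp_comp _ E (path_opsys E) H (fun x h => phi x h - psi x h) (tensor_ev t)) => //.
    exact: (@tensor_ev_pos R E t).
  by exists c => x h; exact: (cP (tensor_cst x) h).
- move=> K V psi [Viso upsi dil].
  have [|L [W [rho [[Wiso urho] VW VWK psiE]]]] := max K V (fun F => psi (tensor_ev t F)).
    split=> //; first exact: ucp_ev.
    by move=> F h h'; rewrite PhiE; exact: dil.
  exists L, W, (fun x => rho (tensor_cst x)); split=> //.
    by split=> //; exact: ucp_cst.
  by move=> x h l; exact: (psiE (tensor_cst x) h l).
Qed.

(** A map dominated by [phi o ev_t] kills [sqdist t], so it factors through
    [ev_t] too. *)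
Lemma pure_ev H (phi : E -> H -> H) t : is_pure phi ->
  is_pure (fun F : path_opsys E => phi (tensor_ev t F)).
Proof.
move=> [cp [x0 [h0 xh0]] pure].
have evcp : is_cp (fun F : path_opsys E => phi (tensor_ev t F)).
  by apply: (@cp_comp _ _ (path_opsys E)) => //; exact: (@tensor_ev_pos R E t).
split=> //; first by exists (tensor_cst x0), h0.
move=> psi psicp subcp.
have sq0 h : hdot H (psi (sqdist t) h) h = 0.
  have Pq : opos (path_opsys E) ((sqdist t)%:M : 'M[tensor E]_1).
    by apply: funit_pos => s; exists ((sval s - sval t) ^+ 2) => //; rewrite sqr_ge0.
  have := cp_ge0 psicp Pq h; have := cp_ge0 subcp Pq h.
  rewrite (_ : tensor_ev t (sqdist t) = 0).
    by rewrite (cp0 cp) sub0r hdotNl oppr_ge0 => p1 p2; apply/eqP; rewrite eq_le p1.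
  rewrite -[LHS]/(((sval t - sval t) ^+ 2)%:C *: _).
  by rewrite subrr expr0n /= scale0r.
have psiE F h : psi F h = psi (tensor_cst (F t)) h by exact: cp_localize.
have [||c cP] := pure (fun x => psi (tensor_cst x)).
- apply: (@cp_comp _ (path_opsys E) E H psi (@tensor_cst R E) _ _ psicp).
    exact: tensor_cst_linear.
  exact: tensor_cst_pos.
- apply: (@cp_comp _ (path_opsys E) E H _ (@tensor_cst R E) _ _ subcp).
    exact: tensor_cst_linear.
  exact: tensor_cst_pos.
by exists c => F h; rewrite psiE cP.
Qed.

(** A dilation [Psi] of [phi o ev_t] restricts to a dilation of [phi] on constant
    paths, which splits by maximality. On the range of [V] the map [Psi] is
    concentrated at [t], so every [Psi F] preserves that range; being closed
    under adjoints, the family also preserves the orthogonal complement. *)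
Lemma maximal_ev H (phi : E -> H -> H) t : is_maximal phi ->
  is_maximal (fun F : path_opsys E => phi (tensor_ev t F)).
Proof.
move=> max K V Psi [Viso uPsi dil]; have [cp u] := uPsi.
have [|L [W [rho [[Wiso urho] VW VWK PsiE]]]] := max K V (fun x => Psi (tensor_cst x)).
  by split=> [||x h h']; [|exact: ucp_cst|exact: dil (tensor_cst x) h h'].
have [[Vl Vd] [Wl Wd]] := (Viso, Wiso).
have [rcp ru] := urho.
have PsiV F h : Psi F (V h) = V (phi (F t) h).
  have <- : Psi (tensor_cst (F t)) (V h) = V (phi (F t) h).
    have := PsiE (F t) h 0; rewrite (linear_fun0 Wl) addr0 => ->.
    by rewrite (linear_fun0 (cp_linear rcp _)) (linear_fun0 Wl) addr0.
  apply: cp_localize => //; apply: eq_trans (_ : hdot K (V (phi 0 h)) (V h) = 0).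
    have := dil (sqdist t) h h; rewrite hdotDl hdotNl => /eqP; rewrite subr_eq0 => /eqP ->.
    rewrite (_ : tensor_ev t (sqdist t) = 0) //.
    rewrite -[LHS]/(((sval t - sval t) ^+ 2)%:C *: _).
    by rewrite subrr expr0n /= scale0r.
  have := dil 0 h h; rewrite (cp0 cp) sub0r hdotNl => /eqP.
  by rewrite oppr_eq0 => /eqP.
(* [Psi F] maps the range of [W] to itself: its [V]-component there is
   orthogonal to [V a], by adjointness and [PsiV]. *)
have /choice[r rP] (p : path_opsys E * L) : exists l', Psi p.1 (W p.2) = W l'.
  case: p => F l /=; have [a [b ab]] := VWK (Psi F (W l)).
  exists b; rewrite ab -[RHS]add0r; congr (_ + _); apply: hdot_eq0.
  have : hdot K (Psi F (W l)) (V a) = 0.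
    by rewrite (cp_adjoint _ _ _ cp) PsiV hdotC VW rmorph0.
  by rewrite ab hdotDl (hdotC (W b)) VW rmorph0 addr0.
have Winj l l' : W l = W l' -> l = l'.
  move=> ll; apply/eqP; rewrite -subr_eq0; apply/eqP/hdot_eq0.
  by rewrite -Wd linear_funB // ll subrr hdot0l.
pose rho' (F : path_opsys E) l := r (F, l).
have rhoE F l : Psi F (W l) = W (rho' F l) := rP (F, l).
exists L, W, rho'; split=> //; last first.
  move=> F h l; rewrite (linear_funD (cp_linear cp _)) PsiV rhoE //.
split=> //; split; last by move=> l; apply: Winj; rewrite -rhoE; have [_ ->] := uPsi.
split=> [F|a F G l|n X X0 f].
- have [_ [M MP]] : bounded_op (Psi F) by case: cp => /(_ F).
  split=> [a l l'|].
    by apply: Winj; rewrite -rhoE Wl (cp_linear cp) !rhoE Wl.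
  by exists M => l; rewrite -(hnorm_isometric _ Wiso) -rhoE -(hnorm_isometric l Wiso).
- by apply: Winj; rewrite Wl -!rhoE (cpD cp) (cpZ cp).
- have [_ _ pos] := cp; have := pos n X X0 [ffun i => W (f i)].
  rewrite !hdot_hpower; congr (0 <= _); apply: eq_bigr => i _.
  rewrite !ffunE -Wd; congr (hdot K _ _).
  rewrite (big_morph W (linear_funD Wl) (linear_fun0 Wl)).
  by apply: eq_bigr => j _; rewrite !ffunE rhoE.
Qed.

End PureRepresentations.
(** * Uniform lower bounds *)

Section Moduli.
Context {R : realType}.
Implicit Types H K : hilbert R.

Definition modulus_ge H (T : H -> H) (g : R) : Prop :=
  exists2 A, is_absop T A & op_ge A g.

Lemma modulus_ge_le H (T : H -> H) (g g' : R) :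
  g' <= g -> modulus_ge T g -> modulus_ge T g'.
Proof.
move=> gg [A Aabs Ag]; exists A => // h; apply: le_trans (Ag h) _.
by rewrite !hdotDl !hdotNl !hdotZl lerD2l lerN2 ler_wpM2r ?lecR // hdot_ge0.
Qed.

Lemma modulus_scalar H (T : H -> H) (c : R) :
  (forall h, T h = c%:C *: h) -> modulus_ge T `|c|.
Proof.
move=> TE.
have bd (d : R) : bounded_op (fun h : H => d%:C *: h).
  split=> [a u v|]; first by rewrite scalerDr !scalerA mulrC.
  exists `|d| => h; rewrite -(@ler_pXn2r _ 2) ?nnegrE ?mulr_ge0 ?hnorm_ge0 //.
  rewrite -lecR exprMn hnorm_sqr [leRHS]rmorphM /= hnorm_sqr hdotZl hdotZr conjcR mulrA.
  by rewrite -rmorphM -expr2 -real_normK ?num_real.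
exists (fun h => `|c|%:C *: h); last first.
  by move=> h; rewrite subrr hdot0l.
split=> [|h|]; first exact: bd.
  by rewrite hdotZl mulr_ge0 ?hdot_ge0 // lecR.
exists (fun h => c%:C *: h).
  by split=> // h k; rewrite TE hdotZl hdotZr conjcR.
by move=> h; rewrite TE !scalerA -!rmorphM -!expr2 real_normK ?num_real.
Qed.

(** With [Q = P^*], the modulus of [P^* T P] is [P^* |T| P]. *)
Lemma modulus_unitary H K (P : K -> H) (Q : H -> K) (T : H -> H) (g : R) :
  isometric P -> isometric Q -> cancel P Q -> cancel Q P ->
  modulus_ge T g -> modulus_ge (fun k => Q (T (P k))) g.
Proof.
move=> Piso Qiso PK QK [A [[Al [M MP]] Ap [S [[Sl [N NP]] adj] AS]] Ag].
have [[Pl Pd] [Ql Qd]] := (Piso, Qiso).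
have QP h k : hdot K (Q h) k = hdot H h (P k) by rewrite -{1}(PK k) Qd.
have PQ h k : hdot H (P k) h = hdot K k (Q h) by rewrite -{1}(QK h) Pd.
have bd (B : H -> H) M' : linear B -> (forall h, hnorm (B h) <= M' * hnorm h) ->
    bounded_op (fun k => Q (B (P k))).
  move=> Bl BM; split=> [a u v|]; first by rewrite Pl Bl Ql.
  exists M' => h; rewrite (hnorm_isometric _ Qiso) -(hnorm_isometric h Piso).
  exact: BM.
exists (fun k => Q (A (P k))); last first.
  move=> k; have := Ag (P k).
  by rewrite !hdotDl !hdotNl !hdotZl QP Pd.
split=> [|k|]; first exact: bd Al MP.
  by rewrite QP; exact: Ap.
exists (fun k => Q (S (P k))).
  by split=> [|h k]; [exact: bd Sl NP|rewrite QP adj PQ].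
by move=> k; rewrite !QK AS.
Qed.

Section DirectSum.
Variables (H : hilbert R) (p q : nat).

Definition lpart (v : hpower H (p + q)) : hpower H p := [ffun i => v (lshift q i)].
Definition rpart (v : hpower H (p + q)) : hpower H q := [ffun i => v (rshift p i)].
Definition glue (a : hpower H p) (b : hpower H q) : hpower H (p + q) :=
  [ffun k => match fintype.split k with inl i => a i | inr j => b j end].

Lemma lpart_glue a b : lpart (glue a b) = a.
Proof. by apply/ffunP => i; rewrite !ffunE (unsplitK (inl i)). Qed.

Lemma rpart_glue a b : rpart (glue a b) = b.
Proof. by apply/ffunP => i; rewrite !ffunE (unsplitK (inr i)). Qed.

Lemma lpart_linear : linear lpart.
Proof. by move=> c u v; apply/ffunP => i; rewrite !ffunE. Qed.

Lemma rpart_linear : linear rpart.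
Proof. by move=> c u v; apply/ffunP => i; rewrite !ffunE. Qed.

Lemma glueP c a a' b b' :
  glue (c *: a + a') (c *: b + b') = c *: glue a b + glue a' b'.
Proof. by apply/ffunP => k; rewrite !ffunE; case: fintype.split => i; rewrite !ffunE. Qed.

Lemma hdot_parts u v : hdot (hpower H (p + q)) u v =
  hdot (hpower H p) (lpart u) (lpart v) + hdot (hpower H q) (rpart u) (rpart v).
Proof.
by rewrite !hdot_hpower big_split_ord /=; congr (_ + _); apply: eq_bigr => i _;
  rewrite !ffunE.
Qed.

(** Pythagoras; the constant is the larger of the two, in absolute value as
    nothing forces the given bounds to be nonnegative. *)
Lemma bounded_glue (A : hpower H p -> hpower H p) (B : hpower H q -> hpower H q) :
  bounded_op A -> bounded_op B ->
  bounded_op (fun v => glue (A (lpart v)) (B (rpart v))).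
Proof.
move=> [Al [M MP]] [Bl [N NP]]; split=> [c u v|].
  by rewrite lpart_linear rpart_linear Al Bl glueP.
pose C := Num.max `|M| `|N|.
have C0 : 0 <= C by rewrite le_max normr_ge0.
exists C => v; rewrite -(@ler_pXn2r _ 2) ?nnegrE ?mulr_ge0 ?hnorm_ge0 //.
have sq (r : nat) (X : hpower H r -> hpower H r) M' w : `|M'| <= C ->
    (forall h, hnorm (X h) <= M' * hnorm h) ->
    hnorm (X w) ^+ 2 <= C ^+ 2 * hnorm w ^+ 2.
  move=> MC XM; rewrite -exprMn ler_pXn2r ?nnegrE ?mulr_ge0 ?hnorm_ge0 //.
  apply: le_trans (XM w) _; rewrite ler_wpM2r ?hnorm_ge0 //.
  exact: le_trans (ler_norm _) MC.
have norm_parts (w : hpower H (p + q)) : hnorm w ^+ 2 = hnorm (lpart w) ^+ 2 + hnorm (rpart w) ^+ 2.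
  have inj : injective (fun x : R => x%:C) by move=> x y [].
  by apply: inj; rewrite /= rmorphD /= !hnorm_sqr hdot_parts.
rewrite exprMn norm_parts lpart_glue rpart_glue [X in _ * X]norm_parts mulrDr.
by apply: lerD; [apply: sq MP|apply: sq NP]; rewrite le_max lexx ?orbT.
Qed.

(** The modulus of a direct sum is the direct sum of the moduli. *)
Lemma modulus_glue (T : hpower H (p + q) -> hpower H (p + q)) T1 T2 (g : R) :
  (forall v, T v = glue (T1 (lpart v)) (T2 (rpart v))) ->
  modulus_ge T1 g -> modulus_ge T2 g -> modulus_ge T g.
Proof.
move=> TE [A1 [A1b A1p [S1 [S1b adj1] AS1]] A1g] [A2 [A2b A2p [S2 [S2b adj2] AS2]] A2g].
exists (fun v => glue (A1 (lpart v)) (A2 (rpart v))); last first.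
  move=> v; rewrite hdotDl hdotNl hdotZl !hdot_parts lpart_glue rpart_glue.
  have := addr_ge0 (A1g (lpart v)) (A2g (rpart v)).
  by rewrite !hdotDl !hdotNl !hdotZl mulrDr opprD addrACA.
split=> [|v|]; first exact: bounded_glue.
  by rewrite hdot_parts lpart_glue rpart_glue addr_ge0 ?A1p ?A2p.
exists (fun v => glue (S1 (lpart v)) (S2 (rpart v))).
  split=> [|u v]; first exact: bounded_glue.
  by rewrite TE !hdot_parts !lpart_glue !rpart_glue adj1 adj2.
by move=> v; rewrite TE !lpart_glue !rpart_glue AS1 AS2.
Qed.

End DirectSum.

Definition adjmx m n (a : 'M[R[i]]_(m, n)) : 'M[R[i]]_(n, m) := map_mx Num.conj a^T.

Section ScalarMatrices.
Variable H : hilbert R.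

(** The operator [a (x) 1] on powers of [H]. *)
Definition mxact m n (a : 'M[R[i]]_(m, n)) (h : hpower H n) : hpower H m :=
  [ffun i => \sum_j a i j *: h j].

Lemma mxact_linear m n (a : 'M[R[i]]_(m, n)) : linear (mxact a).
Proof.
move=> c u v; apply/ffunP => i; rewrite !ffunE scaler_sumr -big_split /=.
by apply: eq_bigr => j _; rewrite !ffunE scalerDr !scalerA mulrC.
Qed.

Lemma mxact_mul m n p (a : 'M[R[i]]_(m, n)) (b : 'M[R[i]]_(n, p)) h :
  mxact a (mxact b h) = mxact (a *m b) h.
Proof.
apply/ffunP => i; rewrite !ffunE.
under eq_bigr => j _ do rewrite ffunE scaler_sumr.
rewrite exchange_big; apply: eq_bigr => k _ /=.
rewrite mxE scaler_suml; apply: eq_bigr => j _.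
by rewrite scalerA.
Qed.

Lemma mxact1 n h : mxact (1%:M : 'M[R[i]]_n) h = h.
Proof.
apply/ffunP => i; rewrite !ffunE (bigD1 i) //= mxE eqxx scale1r big1 ?addr0 //.
by move=> j /negPf ji; rewrite mxE eq_sym ji scale0r.
Qed.

Lemma mxact_adj m n (a : 'M[R[i]]_(m, n)) h k :
  hdot (hpower H m) (mxact a h) k = hdot (hpower H n) h (mxact (adjmx a) k).
Proof.
rewrite !hdot_hpower.
transitivity (\sum_i \sum_j a i j * hdot H (h j) (k i)).
  apply: eq_bigr => i _; rewrite ffunE linear_sumlz; apply: eq_bigr => j _.
  exact: hdotZl.
rewrite exchange_big; apply: eq_bigr => j _ /=.
rewrite ffunE linear_sumr; apply: eq_bigr => i _.
by apply: esym; apply: etrans (hdotZr _ _ _) _; rewrite !mxE conjCK.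
Qed.

Lemma adjmxK m n (a : 'M[R[i]]_(m, n)) : adjmx (adjmx a) = a.
Proof. by apply/matrixP => i j; rewrite !mxE conjCK. Qed.

(** [phi] commutes with scalar matrices: [phi (a^* x a) = a^* phi(x) a]. *)
Lemma amp_congr (E : opsys R) (phi : E -> H -> H) n m (a : 'M[R[i]]_(n, m)) (x : 'M[E]_n) h :
  is_cp phi -> amp phi (mxcongr a x) h = mxact (adjmx a) (amp phi x (mxact a h)).
Proof.
move=> cp; apply/ffunP => i; rewrite !ffunE.
transitivity (\sum_j \sum_k \sum_l (Num.conj (a k i) * a l j) *: phi (x k l) (h j)).
  apply: eq_bigr => j _; rewrite mxE (cp_sum cp); apply: eq_bigr => k _.
  by rewrite (cp_sum cp); apply: eq_bigr => l _; rewrite (cpZ cp).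
rewrite exchange_big; apply: eq_bigr => k _ /=.
rewrite !mxE ffunE scaler_sumr exchange_big; apply: eq_bigr => l _ /=.
rewrite ffunE (big_morph _ (linear_funD (cp_linear cp _)) (linear_fun0 (cp_linear cp _))).
rewrite scaler_sumr; apply: eq_bigr => j _.
by rewrite (linear_funZ (cp_linear cp _)) scalerA.
Qed.

End ScalarMatrices.
End Moduli.
Section BoundedBelow.
Context {R : realType} {E : opsys R}.
Implicit Types H : hilbert R.

Definition unitarymx m n (a : 'M[R[i]]_(m, n)) : Prop :=
  adjmx a *m a = 1%:M /\ a *m adjmx a = 1%:M.

Lemma modulus_congr H (phi : E -> H -> H) m n (a : 'M[R[i]]_(m, n)) (y : 'M[E]_m) g :
  is_cp phi -> unitarymx a ->
  modulus_ge (amp phi y) g -> modulus_ge (amp phi (mxcongr a y)) g.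
Proof.
move=> cp [aa aa'] yg.
rewrite (_ : amp phi _ = fun h => mxact (adjmx a) (amp phi y (mxact a h))); last first.
  by apply/funext => h; exact: amp_congr.
have ca : cancel (@mxact R H _ _ a) (mxact (adjmx a)).
  by move=> h; rewrite mxact_mul aa mxact1.
have ca' : cancel (@mxact R H _ _ (adjmx a)) (mxact a).
  by move=> h; rewrite mxact_mul aa' mxact1.
apply: modulus_unitary => //; split; try exact: mxact_linear.
  by move=> h h'; rewrite mxact_adj mxact_mul aa mxact1.
by move=> h h'; rewrite mxact_adj mxact_mul adjmxK aa' mxact1.
Qed.

Lemma modulus_dsum H (phi : E -> H -> H) m n (x : 'M[E]_m) (y : 'M[E]_n) g :
  is_cp phi -> modulus_ge (amp phi x) g -> modulus_ge (amp phi y) g ->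
  modulus_ge (amp phi (dsum x y)) g.
Proof.
move=> cp; apply: modulus_glue => v; apply/ffunP => k; rewrite !ffunE.
rewrite big_split_ord /=; case: (split_ordP k) => i ->.
  rewrite ffunE [X in _ + X]big1 ?addr0 => [|j _].
    by apply: eq_bigr => j _; rewrite block_mxEul ffunE.
  by rewrite block_mxEur mxE (cp0 cp).
rewrite ffunE [X in X + _]big1 ?add0r => [|j _].
  by apply: eq_bigr => j _; rewrite block_mxEdr ffunE.
by rewrite block_mxEdl mxE (cp0 cp).
Qed.

Lemma bounded_below_congr m n (a : 'M[R[i]]_(m, n)) (y : 'M[E]_m) : unitarymx a ->
  unif_bounded_below y -> unif_bounded_below (mxcongr a y).
Proof.
move=> ua [g g0 yg]; exists g => // H phi ucp pure max.
by apply: modulus_congr => //; [case: ucp|exact: yg].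
Qed.

Lemma bounded_below_dsum m n (x : 'M[E]_m) (y : 'M[E]_n) :
  unif_bounded_below x -> unif_bounded_below y -> unif_bounded_below (dsum x y).
Proof.
move=> [g g0 xg] [g' g'0 yg]; exists (Num.min g g') => [|H phi ucp pure max].
  by rewrite lt_min g0.
have [cp _] := ucp; apply: modulus_dsum => //.
  by apply: modulus_ge_le (xg _ _ ucp pure max); rewrite ge_min lexx.
by apply: modulus_ge_le (yg _ _ ucp pure max); rewrite ge_min lexx orbT.
Qed.

(** The scalar matrix [a] times the unit, [a (x) e]. *)
Definition escal m n (a : 'M[R[i]]_(m, n)) : 'M[E]_(m, n) :=
  map_mx (fun c => c *: ounit E) a.

Lemma escal1 n : escal (1%:M : 'M[R[i]]_n) = (ounit E)%:M.
Proof.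
by apply/matrixP => i j; rewrite !mxE; case: (i == j); rewrite /= ?scale1r ?scale0r.
Qed.

Lemma escal_scalar n c : escal (c%:M : 'M[R[i]]_n) = mxscale c (ounit E)%:M.
Proof.
by apply/matrixP => i j; rewrite !mxE; case: (i == j); rewrite /= ?scale0r ?scaler0.
Qed.

Lemma mxcongr_escal m n (a : 'M[R[i]]_(m, n)) (b : 'M[R[i]]_m) :
  mxcongr a (escal b) = escal (adjmx a *m b *m a).
Proof.
apply/matrixP => i j; rewrite !mxE scaler_suml exchange_big; apply: eq_bigr => l _ /=.
rewrite mxE mulr_suml scaler_suml; apply: eq_bigr => k _.
by rewrite !mxE scalerA; congr (_ *: _); ring.
Qed.

Lemma bounded_below_scalar n (c : R) : c != 0 -> unif_bounded_below (escal (c%:C%:M : 'M[R[i]]_n)).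
Proof.
move=> c0; exists `|c| => [|H phi [cp u] _ _]; first by rewrite normr_gt0.
apply: modulus_scalar => h; apply/ffunP => i; rewrite !ffunE (bigD1 i) //=.
rewrite !mxE eqxx (cpZ cp) u big1 ?addr0 // => j /negPf ji.
by rewrite !mxE eq_sym ji scale0r (cp0 cp).
Qed.

Lemma shiftedE s n (x : 'M[E]_n) :
  shifted s x = block_mx (escal s%:C%:M) x (mxstar ostar x) (escal s%:C%:M).
Proof.
rewrite /shifted -escal_scalar scalar_mx_block /escal map_block_mx add_block_mx.
by congr block_mx; rewrite ?addr0 //; apply/matrixP => i j; rewrite !mxE scale0r add0r.
Qed.

Lemma mxstar_unit n : mxstar ostar ((ounit E)%:M : 'M[E]_n) = (ounit E)%:M.
Proof.
apply/matrixP => i j; rewrite !mxE eq_sym.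
by case: (i == j); rewrite /= ?ounit_sa ?ostar0.
Qed.

(** The Hadamard matrix diagonalizes the shifted unit, with eigenvalues
    [s + 1] and [s - 1]. *)
Lemma bounded_below_shifted_unit n (s : R) : 0 <= s < 1 ->
  unif_bounded_below (shifted s ((ounit E)%:M : 'M[E]_n)).
Proof.
move=> /andP[s0 s1].
pose r : R[i] := (Num.sqrt 2^-1)%:C.
have rr : r * r *+ 2 = 1.
  rewrite -rmorphM -expr2 sqr_sqrtr ?invr_ge0 // -rmorphMn /= -mulr_natr mulVf //.
have rc : Num.conj r = r := conjcR _.
pose v : 'M[R[i]]_(n + n) := block_mx r%:M r%:M r%:M (- r)%:M.
have av : adjmx v = v.
  rewrite /adjmx tr_block_mx map_block_mx !tr_scalar_mx !map_scalar_mx /=.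
  by rewrite rmorphN /= rc.
(* [r ^ 2 = 1 / 2], whence [r ^ 2 (b + c) = s] for [b, c = s + 1, s - 1]. *)
have mulv (b c : R[i]) : v *m block_mx b%:M 0 0 c%:M *m v =
    block_mx (r * r * (b + c))%:M (r * r * (b - c))%:M
             (r * r * (b - c))%:M (r * r * (b + c))%:M.
  rewrite /v !mulmx_block !mulmx0 ?addr0 ?add0r -!scalar_mxM -!raddfD /=.
  by congr block_mx; congr (_%:M); ring.
have vv : v *m v = 1%:M.
  have := mulv 1 1; rewrite -scalar_mx_block mulmx1 => ->.
  by rewrite subrr mulr0 -mulr2n mulr_natr rr raddf0 -scalar_mx_block.
have -> : shifted s ((ounit E)%:M : 'M[E]_n) = mxcongr v
    (dsum (escal (s + 1)%:C%:M : 'M[E]_n) (escal (s - 1)%:C%:M : 'M[E]_n)).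
  have -> : dsum (escal (s + 1)%:C%:M) (escal (s - 1)%:C%:M) =
      escal (block_mx (s + 1)%:C%:M 0 0 (s - 1)%:C%:M : 'M[R[i]]_(n + n)).
    rewrite /escal map_block_mx; congr block_mx;
    by apply/matrixP => i j; rewrite !mxE scale0r.
  rewrite mxcongr_escal av mulv shiftedE mxstar_unit -escal1 /escal -map_block_mx.
  congr map_mx; rewrite !rmorphD rmorphN rmorph1.
  have -> : r * r * (s%:C + 1 + (s%:C - 1)) = (r * r *+ 2) * s%:C by ring.
  have -> : r * r * (s%:C + 1 - (s%:C - 1)) = r * r *+ 2 by ring.
  by rewrite rr mul1r.
apply: bounded_below_congr; first by rewrite /unitarymx av.
apply: bounded_below_dsum; apply: bounded_below_scalar; first by rewrite gt_eqF // ltr_wpDl.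
by rewrite lt_eqF // subr_lt0.
Qed.

Lemma mxcongr_block m n (a : 'M[R[i]]_(m, n)) (x y z w : 'M[E]_m) :
  mxcongr (block_mx a 0 0 a) (block_mx x y z w) =
  block_mx (mxcongr a x) (mxcongr a y) (mxcongr a z) (mxcongr a w).
Proof.
have z0 (b : R[i]) (u : E) : (Num.conj 0 * b) *: u = 0 by rewrite rmorph0 mul0r scale0r.
have M0 i j : (0 : 'M[R[i]]_(m, n)) i j = 0 by rewrite mxE.
have z0' (b : R[i]) (u : E) : (b * 0) *: u = 0 by rewrite mulr0 scale0r.
have s0 (I : finType) (G : I -> E) : (forall i, G i = 0) -> \sum_i G i = 0.
  by move=> G0; rewrite big1.
apply/matrixP => i j; case: (split_ordP i) => i' ->; case: (split_ordP j) => j' ->;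
  rewrite ?block_mxEul ?block_mxEur ?block_mxEdl ?block_mxEdr !mxE big_split_ord /=.
- rewrite [X in _ + X]s0 ?addr0 => [|k]; last first.
    by apply: s0 => l; rewrite block_mxEdl M0 z0.
  apply: eq_bigr => k _; rewrite big_split_ord /= [X in _ + X]s0 ?addr0 => [|l].
    by apply: eq_bigr => l _; rewrite !block_mxEul.
  by rewrite block_mxEdl M0 z0'.
- rewrite [X in _ + X]s0 ?addr0 => [|k]; last first.
    by apply: s0 => l; rewrite block_mxEdl M0 z0.
  apply: eq_bigr => k _; rewrite big_split_ord /= [X in X + _]s0 ?add0r => [|l].
    by apply: eq_bigr => l _; rewrite !block_mxEul !block_mxEur !block_mxEdr.
  by rewrite block_mxEur M0 z0'.
- rewrite [X in X + _]s0 ?add0r => [|k]; last first.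
    by apply: s0 => l; rewrite block_mxEur M0 z0.
  apply: eq_bigr => k _; rewrite big_split_ord /= [X in _ + X]s0 ?addr0 => [|l].
    by apply: eq_bigr => l _; rewrite !block_mxEul !block_mxEdl !block_mxEdr.
  by rewrite block_mxEdl M0 z0'.
- rewrite [X in X + _]s0 ?add0r => [|k]; last first.
    by apply: s0 => l; rewrite block_mxEur M0 z0.
  apply: eq_bigr => k _; rewrite big_split_ord /= [X in X + _]s0 ?add0r => [|l].
    by apply: eq_bigr => l _; rewrite !block_mxEdr.
  by rewrite block_mxEur M0 z0'.
Qed.

Lemma mxstar_congr m n (a : 'M[R[i]]_(m, n)) (x : 'M[E]_m) :
  mxstar ostar (mxcongr a x) = mxcongr a (mxstar ostar x).
Proof.
have ostar_sum (I : finType) (G : I -> E) : ostar (\sum_i G i) = \sum_i ostar (G i).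
  by rewrite (big_morph _ (@ostarD _ E) (@ostar0 _ E)).
apply/matrixP => i j; rewrite !mxE ostar_sum exchange_big; apply: eq_bigr => k _ /=.
rewrite ostar_sum; apply: eq_bigr => l _.
by rewrite ostarZ rmorphM /= conjCK !mxE mulrC.
Qed.

(** Unitarity of [a] is what keeps the scalar shift [s e] in place. *)
Lemma shifted_congr s m n (a : 'M[R[i]]_(m, n)) (x : 'M[E]_m) : unitarymx a ->
  shifted s (mxcongr a x) = mxcongr (block_mx a 0 0 a) (shifted s x).
Proof.
move=> [aa _]; rewrite !shiftedE mxcongr_block mxcongr_escal mxstar_congr.
by rewrite -mulmxA mul_scalar_mx -scalemxAr aa scalemx1.
Qed.

Lemma unitarymx_block m n (a : 'M[R[i]]_(m, n)) : unitarymx a ->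
  unitarymx (block_mx a 0 0 a : 'M[R[i]]_(m + m, n + n)).
Proof.
move=> [aa aa']; rewrite /unitarymx.
have -> : adjmx (block_mx a 0 0 a) = block_mx (adjmx a) 0 0 (adjmx a).
  by rewrite /adjmx tr_block_mx map_block_mx !trmx0 !map_mx0.
by split; rewrite mulmx_block !mulmx0 !mul0mx !addr0 !add0r ?aa ?aa' -scalar_mx_block.
Qed.

(** The permutation matrix of [f], for domain and codomain of sizes that need
    not be convertible. *)
Definition pmx m n (f : 'I_n -> 'I_m) : 'M[R[i]]_(m, n) := \matrix_(k, i) (k == f i)%:R.

Lemma pmx_unitary m n (f : 'I_n -> 'I_m) : bijective f -> unitarymx (pmx f).
Proof.
move=> [g fK gK]; split; apply/matrixP => i j; rewrite !mxE.
  rewrite (bigD1 (f i)) //= big1 ?addr0 => [|k /negPf ki]; rewrite !mxE ?eqxx ?ki.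
    by rewrite rmorph1 mul1r (can_eq fK).
  by rewrite rmorph0 mul0r.
rewrite (bigD1 (g i)) //= big1 ?addr0 => [|k ki]; rewrite !mxE.
  by rewrite gK eqxx mul1r eq_sym rmorph_nat.
have /negPf -> : i != f k by rewrite -(can_eq gK) fK eq_sym.
by rewrite mul0r.
Qed.

Lemma mxcongr_pmx m n (f : 'I_n -> 'I_m) (x : 'M[E]_m) :
  mxcongr (pmx f) x = mxsub f f x.
Proof.
apply/matrixP => i j; rewrite !mxE (bigD1 (f i)) //= [X in _ + X]big1 ?addr0.
  rewrite (bigD1 (f j)) //= big1 ?addr0 => [|l /negPf lj]; rewrite !mxE ?eqxx.
    by rewrite rmorph1 mul1r scale1r.
  by rewrite lj mulr0 scale0r.
move=> k /negPf ki; rewrite big1 // => l _.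
by rewrite !mxE ki rmorph0 mul0r scale0r.
Qed.

Lemma mxcongr1 n (x : 'M[E]_n) : mxcongr 1%:M x = x.
Proof.
have -> : 1%:M = pmx id :> 'M[R[i]]_n by apply/matrixP => i j; rewrite !mxE.
by rewrite mxcongr_pmx; apply/matrixP => i j; rewrite mxE.
Qed.

(** Doubling [x (+) y] orders the coordinates as [n, m, n, m], whereas the direct
    sum of the doublings of [x] and [y] has [n, n, m, m]. *)
Definition interchange n m n' m' (k : 'I_((n + m) + (n' + m'))) :
    'I_((n + n') + (m + m')) :=
  match fintype.split k with
  | inl k' => match fintype.split k' with
              | inl i => lshift (m + m') (lshift n' i)
              | inr j => rshift (n + n') (lshift m' j)
              end
  | inr k' => match fintype.split k' with
              | inl i => lshift (m + m') (rshift n i)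
              | inr j => rshift (n + n') (rshift m j)
              end
  end.

Lemma interchange_ul n m n' m' i :
  @interchange n m n' m' (lshift _ (lshift _ i)) = lshift _ (lshift _ i).
Proof. by rewrite /interchange (unsplitK (inl (lshift _ i))) (unsplitK (inl i)). Qed.

Lemma interchange_ur n m n' m' i :
  @interchange n m n' m' (lshift _ (rshift _ i)) = rshift _ (lshift _ i).
Proof. by rewrite /interchange (unsplitK (inl (rshift _ i))) (unsplitK (inr i)). Qed.

Lemma interchange_dl n m n' m' i :
  @interchange n m n' m' (rshift _ (lshift _ i)) = lshift _ (rshift _ i).
Proof. by rewrite /interchange (unsplitK (inr (lshift _ i))) (unsplitK (inl i)). Qed.

Lemma interchange_dr n m n' m' i :
  @interchange n m n' m' (rshift _ (rshift _ i)) = rshift _ (rshift _ i).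
Proof. by rewrite /interchange (unsplitK (inr (rshift _ i))) (unsplitK (inr i)). Qed.

Definition interchangeE :=
  (interchange_ul, interchange_ur, interchange_dl, interchange_dr).

Lemma interchangeK n m n' m' :
  cancel (@interchange n m n' m') (@interchange n n' m m').
Proof.
by move=> k; case: (split_ordP k) => k' ->; case: (split_ordP k') => i ->;
  rewrite !interchangeE.
Qed.

Lemma interchange_bij n m n' m' : bijective (@interchange n m n' m').
Proof. by exists (@interchange n n' m m'); exact: interchangeK. Qed.

Lemma mxstar_dsum n m (x : 'M[E]_n) (y : 'M[E]_m) :
  mxstar ostar (dsum x y) = dsum (mxstar ostar x) (mxstar ostar y).
Proof.
rewrite /mxstar /dsum map_block_mx tr_block_mx; congr block_mx;
by apply/matrixP => i j; rewrite !mxE ostar0.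
Qed.

Lemma escal_block n m (c : R[i]) :
  escal (c%:M : 'M[R[i]]_(n + m)) = dsum (escal c%:M) (escal c%:M).
Proof.
rewrite /escal scalar_mx_block map_block_mx; congr block_mx;
by apply/matrixP => i j; rewrite !mxE scale0r.
Qed.

Lemma shifted_dsum s n m (x : 'M[E]_n) (y : 'M[E]_m) :
  shifted s (dsum x y) =
  mxsub (@interchange n m n m) (@interchange n m n m) (dsum (shifted s x) (shifted s y)).
Proof.
rewrite !shiftedE mxstar_dsum !escal_block; apply/matrixP => i j; rewrite [RHS]mxE.
case: (split_ordP i) => i' ->; case: (split_ordP i') => i'' ->;
case: (split_ordP j) => j' ->; case: (split_ordP j') => j'' ->;
by rewrite !interchangeE /dsum
  ?(block_mxEul, block_mxEur, block_mxEdl, block_mxEdr) ?[in RHS]mxE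
  ?(block_mxEul, block_mxEur, block_mxEdl, block_mxEdr) ?[in LHS]mxE.
Qed.

End BoundedBelow.
(** * Homotopies of singular elements *)

Section SingularElements.
Context {R : realType} {E : opsys R}.
Variable delta : R.

(** Turns the two cases in the definition of [delta]-singularity into a single
    quantification over shifts. *)
Definition shift_range (s : R) : Prop := if delta == 0 then s = 0 else 0 < s < delta.

Lemma HsetP n (x : 'M[E]_n) : Hset delta x <->
  mxstar ostar x = x /\ forall s, shift_range s -> unif_bounded_below (shifted s x).
Proof.
rewrite /Hset /= /delta_singular /shift_range; case: eqP => _.
  by split=> -[sx bx]; [split=> // s ->|split=> //; exact: bx].
by split.
Qed.

Lemma Hset_dsum n m (x : 'M[E]_n) (y : 'M[E]_m) :
  Hset delta x -> Hset delta y -> Hset delta (dsum x y).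
Proof.
move=> /HsetP[sx bx] /HsetP[sy bY]; apply/HsetP; split.
  by rewrite mxstar_dsum sx sy.
move=> s sr; rewrite shifted_dsum -mxcongr_pmx; apply: bounded_below_congr.
  by apply: pmx_unitary; exact: interchange_bij.
by apply: bounded_below_dsum; [exact: bx|exact: bY].
Qed.

Lemma Hset_unit n : 0 <= delta -> delta <= 1 -> Hset delta ((ounit E)%:M : 'M[E]_n).
Proof.
move=> d0 d1; apply/HsetP; split; first exact: mxstar_unit.
move=> s sr; apply: bounded_below_shifted_unit; move: sr; rewrite /shift_range.
case: eqP => [_ ->|_ /andP[s0 sd]]; first by rewrite lexx ltr01.
by rewrite ltW // (lt_le_trans sd).
Qed.

End SingularElements.

Section Homotopy.
Context {R : realType} {E : opsys R}.
Variable delta : R.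
Implicit Types t : @unitI R.

Lemma tensor_mxev_shifted t s n (F : 'M[tensor E]_n) :
  tensor_mxev t (shifted s (F : 'M[path_opsys E]_n)) = shifted s (tensor_mxev t F).
Proof.
rewrite /shifted tensor_mxevD; congr (_ + _).
  by rewrite tensor_mxevZ; congr (mxscale _ _); exact: tensor_mxev_unit.
rewrite /tensor_mxev map_block_mx; congr block_mx;
  by apply/matrixP => i j; rewrite !mxE.
Qed.

(** The pure maximal representations of the path system are exactly the maps
    [phi o ev_t] with [phi] pure and maximal on [E], so a path is singular if
    and only if its values are, with a bound uniform in the parameter. *)
Lemma Hset_pathP n (F : 'M[path_opsys E]_n) : Hset delta F <->
  mxstar ostar F = F /\
  forall s, shift_range delta s -> exists2 g : R, 0 < g &
    forall t (H : hilbert R) (phi : E -> H -> H),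
      is_ucp phi -> is_pure phi -> is_maximal phi ->
      modulus_ge (amp phi (shifted s (tensor_mxev t F))) g.
Proof.
have ampE t s (H : hilbert R) (phi : E -> H -> H) :
    amp (fun G : path_opsys E => phi (tensor_ev t G)) (shifted s F) =
    amp phi (shifted s (tensor_mxev t F)).
  by apply/funext => h; rewrite amp_comp -tensor_mxev_shifted.
split=> [/HsetP[sF bF]|[sF bF]].
  split=> // s /bF[g g0 gP]; exists g => // t H phi ucp pure max.
  rewrite -ampE; apply: gP; [exact: ucp_ev|exact: pure_ev|exact: maximal_ev].
apply/HsetP; split=> // s /bF[g g0 gP]; exists g => // H Phi ucp pure max.
have [t [phi [uphi pphi mphi ->]]] := path_rep_factor ucp pure max.
by have := gP t H phi uphi pphi mphi; rewrite -ampE.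
Qed.

Lemma mxev_sa t n (F : 'M[path_opsys E]_n) :
  mxstar ostar F = F -> mxstar ostar (tensor_mxev t F) = tensor_mxev t F.
Proof. by move=> sF; rewrite -tensor_mxev_star; congr tensor_mxev. Qed.

Lemma Hset_ev t n (F : 'M[path_opsys E]_n) :
  Hset delta F -> Hset delta (tensor_mxev t F).
Proof.
move=> /Hset_pathP[sF bF]; apply/HsetP; split; first exact: mxev_sa.
by move=> s /bF[g g0 gP]; exists g => // H phi; exact: gP.
Qed.

Definition path_joins n (F : 'M[path_opsys E]_n) (x y : 'M[E]_n) : Prop :=
  tensor_mxev (exist _ 0 unitI0_proof) F = x /\
  tensor_mxev (exist _ 1 unitI1_proof) F = y.

Definition joined n (x y : 'M[E]_n) : Prop :=
  exists2 F : 'M[path_opsys E]_n, Hset delta F & path_joins F x y.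

Lemma homotopicP n (x y : Hdelta E delta n) :
  homotopic x y <-> joined (sval x) (sval y).
Proof.
split=> [[F [F0 F1]]|[F HF [F0 F1]]].
  by exists (sval F) => //; exact: (svalP F).
by exists (exist _ F HF).
Qed.

Lemma joined_Hset n (x y : 'M[E]_n) : joined x y -> Hset delta x /\ Hset delta y.
Proof. by move=> [F HF [<- <-]]; split; exact: Hset_ev. Qed.

(** The constant path. *)
Lemma joined_refl n (x : 'M[E]_n) : Hset delta x -> joined x x.
Proof.
move=> /HsetP[sx bx].
pose F : 'M[path_opsys E]_n := map_mx (@tensor_cst R E) x.
have FE t : tensor_mxev t F = x by apply/matrixP => i j; rewrite !mxE.
exists F => //; apply/Hset_pathP; split.
  by apply: tensor_mx_inj => t; rewrite tensor_mxev_star FE.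
by move=> s /bx[g g0 gP]; exists g => // t H phi *; rewrite FE; exact: gP.
Qed.

Lemma mxev_sval t t' n (F : 'M[tensor E]_n) :
  sval t = sval t' -> tensor_mxev t F = tensor_mxev t' F.
Proof. by move=> tt'; congr (tensor_mxev _ F); exact: val_inj. Qed.

Section Reparametrization.
Variable alpha : R -> R.
Hypothesis alpha_cont : continuous alpha.
Hypothesis alpha01 : forall u, u \in `[0, 1] -> alpha u \in `[0, 1].

Lemma within_reparam (f : R -> R[i]^o) : {within `[0, 1], continuous f} ->
  {within `[0, 1], continuous (f \o alpha)}.
Proof.
move=> /subspace_continuousP fc; apply: (subspace_continuousP _ (f \o alpha)).2 => u u01.
apply: (@cvg_comp _ _ _ alpha f _ (within (fun v : R => v \in `[0, 1]) (nbhs (alpha u)))); last first.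
  exact: fc (alpha01 u01).
move=> A; rewrite /within /= => /alpha_cont.
apply: (@filterS R (nbhs u) (nbhs_filter u)) => v vA v01.
by apply: vA; exact: alpha01.
Qed.

Definition reparam (t : @unitI R) : @unitI R := exist _ (alpha (sval t)) (alpha01 (svalP t)).

Lemma tensor_reparam_proof (F : tensor E) : (fun t => F (reparam t)) \in @tensor_pred R E.
Proof.
have [k [f [x [fc FE]]]] := tensorP F; apply/asboolP.
exists k, (fun i => f i \o alpha), x; split=> [i|t]; last exact: FE.
exact: within_reparam.
Qed.

Definition tensor_reparam (F : tensor E) : tensor E := Tensor (tensor_reparam_proof F).

Lemma tensor_mxev_reparam t n (F : 'M[tensor E]_n) :
  tensor_mxev t (map_mx tensor_reparam F) = tensor_mxev (reparam t) F.
Proof. by apply/matrixP => i j; rewrite !mxE. Qed.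

End Reparametrization.

(** The reversed path. *)
Lemma joined_sym n (x y : 'M[E]_n) : joined x y -> joined y x.
Proof.
move=> [F HF [F0 F1]].
have ac : continuous (fun u : R => 1 - u).
  by move=> u; apply: continuousB => //; exact: cst_continuous.
have a01 u : u \in `[0, 1] -> 1 - u \in `[(0 : R), 1].
  by rewrite !in_itv /= => /andP[u0 u1]; rewrite subr_ge0 u1 gerBl u0.
exists (map_mx (tensor_reparam ac a01) F); last first.
  split; rewrite tensor_mxev_reparam.
    by rewrite -F1; apply: mxev_sval => /=; rewrite subr0.
  by rewrite -F0; apply: mxev_sval => /=; rewrite subrr.
have /Hset_pathP[sF bF] := HF; apply/Hset_pathP; split.
  apply: tensor_mx_inj => t.
  by rewrite tensor_mxev_star !tensor_mxev_reparam mxev_sa.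
move=> s /bF[g g0 gP]; exists g => // t H phi *.
by rewrite tensor_mxev_reparam; exact: gP.
Qed.

(** The concatenation of [F] and [G] through [y], written as
    [F (min (2t) 1) + G (max (2t - 1) 0) - y] so that it is visibly a finite sum
    of simple tensors. *)
Lemma joined_trans n (x y z : 'M[E]_n) : joined x y -> joined y z -> joined x z.
Proof.
move=> [F HF [F0 F1]] [G HG [G0 G1]].
have ac : continuous (fun u : R => Num.min (2 * u) 1).
  move=> u; apply: continuous_min; last exact: cst_continuous.
  by apply: continuousM; [exact: cst_continuous|exact: cvg_id].
have bc : continuous (fun u : R => Num.max (2 * u - 1) 0).
  move=> u; apply: (@continuous_max _ _ (fun u : R => 2 * u - 1) (fun _ => 0)); last exact: cst_continuous.
  apply: continuousB; last exact: cst_continuous.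
  by apply: continuousM; [exact: cst_continuous|exact: cvg_id].
have a01 u : u \in `[0, 1] -> Num.min (2 * u) 1 \in `[(0 : R), 1].
  rewrite !in_itv /= => /andP[u0 u1].
  by rewrite le_min ler01 mulr_ge0 //= ge_min lexx orbT.
have b01 u : u \in `[0, 1] -> Num.max (2 * u - 1) 0 \in `[(0 : R), 1].
  rewrite !in_itv /= => /andP[u0 u1].
  by rewrite le_max lexx orbT /= ge_max ler01 andbT; lra.
pose C : 'M[path_opsys E]_n := map_mx (@tensor_cst R E) y.
pose K : 'M[path_opsys E]_n :=
  (map_mx (tensor_reparam ac a01) F : 'M[tensor E]_n) +
  ((map_mx (tensor_reparam bc b01) G : 'M[tensor E]_n) - C).
have KE t : tensor_mxev t K =
    tensor_mxev (reparam a01 t) F + (tensor_mxev (reparam b01 t) G - y).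
  rewrite tensor_mxevD tensor_mxevD tensor_mxevN !tensor_mxev_reparam.
  by congr (_ + (_ - _)); apply/matrixP => i j; rewrite !mxE.
have Kl t : sval t <= 2^-1 -> tensor_mxev t K = tensor_mxev (reparam a01 t) F.
  move=> t2; rewrite KE (_ : reparam b01 t = exist _ 0 unitI0_proof).
    by rewrite G0 subrr addr0.
  by apply: val_inj => /=; apply/max_idPr; lra.
have Kr t : 2^-1 <= sval t -> tensor_mxev t K = tensor_mxev (reparam b01 t) G.
  move=> t2; rewrite KE (_ : reparam a01 t = exist _ 1 unitI1_proof).
    by rewrite F1 addrCA subrr addr0.
  by apply: val_inj => /=; apply/min_idPr; lra.
exists K; last first.
  split.
    rewrite Kl /= ?invr_ge0 // -F0; apply: mxev_sval => /=.
    by rewrite mulr0; apply/min_idPl.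
  rewrite Kr /=; last lra.
  rewrite -G1; apply: mxev_sval => /=.
  by rewrite mulr1; apply: etrans (_ : (2 - 1) = 1); [apply/max_idPl|]; lra.
have /Hset_pathP[sF bF] := HF; have /Hset_pathP[sG bG] := HG.
apply/Hset_pathP; split.
  apply: tensor_mx_inj => t; rewrite tensor_mxev_star.
  have [t2|/ltW t2] := leP (sval t) 2^-1.
    by rewrite !Kl // mxev_sa.
  by rewrite !Kr // mxev_sa.
move=> s sr; have [g g0 gP] := bF s sr; have [g' g'0 gP'] := bG s sr.
exists (Num.min g g') => [|t H phi u p m]; first by rewrite lt_min g0.
have [t2|/ltW t2] := leP (sval t) 2^-1.
  rewrite Kl //; apply: modulus_ge_le (gP _ H phi u p m).
  by rewrite ge_min lexx.
rewrite Kr //; apply: modulus_ge_le (gP' _ H phi u p m).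
by rewrite ge_min lexx orbT.
Qed.

(** [Hset_dsum] holds for every operator system, in particular for paths. *)
Lemma joined_dsum n m (x x' : 'M[E]_n) (y y' : 'M[E]_m) :
  joined x x' -> joined y y' -> joined (dsum x y) (dsum x' y').
Proof.
move=> [F HF [F0 F1]] [G HG [G0 G1]].
exists (dsum F G); first exact: Hset_dsum.
have ev t : tensor_mxev t (dsum F G) = dsum (tensor_mxev t F) (tensor_mxev t G).
  rewrite /tensor_mxev /dsum map_block_mx; congr block_mx;
  by apply/matrixP => i j; rewrite !mxE.
by split; rewrite ev ?F0 ?F1 ?G0 ?G1.
Qed.

End Homotopy.
(** * Homotopies given by scalar unitaries *)

Section UnitaryPaths.
Context {R : realType} {E : opsys R}.
Variable delta : R.

Lemma continuous_addC (f g : R -> R[i]^o) :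
  continuous f -> continuous g -> continuous (fun u => f u + g u : R[i]^o).
Proof. by move=> fc gc u; exact: (continuousD (fc u) (gc u)). Qed.

Lemma continuous_mulC (f g : R -> R[i]^o) :
  continuous f -> continuous g -> continuous (fun u => (f u : R[i]) * g u : R[i]^o).
Proof. by move=> fc gc u; exact: (@continuousM R[i] _ f g u (fc u) (gc u)). Qed.

Lemma continuous_cstC (c : R[i]) : continuous (fun _ : R => c : R[i]^o).
Proof. by move=> u; exact: cst_continuous. Qed.

(** The path [U(t)^* x U(t)] has entries polynomial in those of [U] and their
    conjugates, and every value has the same lower bounds as [x]. *)
Lemma joined_unitary_path n (U : R -> 'M[R[i]]_n) (x : 'M[E]_n) :
  (forall k i, continuous (fun u => U u k i : R[i]^o)) ->
  (forall u, unitarymx (U u)) -> Hset delta x ->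
  joined delta (mxcongr (U 0) x) (mxcongr (U 1) x).
Proof.
move=> Uc Uu /HsetP[sx bx].
have conjc : continuous (fun z : R[i]^o => Num.conj (z : R[i]) : R[i]^o).
  move=> z; have FF : Filter (nbhs (z : R[i]^o)) by exact: nbhs_filter.
  apply/(@cvgrPdist_lt _ R[i]^o) => eps eps0.
  have zz : (w : R[i]^o) @[w --> (z : R[i]^o)] --> (z : R[i]^o) by exact: cvg_id.
  have := (@cvgrPdist_lt _ R[i]^o _ _ FF id z).1 zz _ eps0.
  by apply: filterS => w; rewrite -rmorphB norm_conjC.
have cc k i l j :
    {within `[0, 1], continuous (fun u => Num.conj (U u k i) * U u l j : R[i]^o)}.
  apply: continuous_subspaceT => u; apply: (@continuousM R[i]); last exact: Uc.
  apply: (@continuous_comp _ _ _ (fun v => U v k i : R[i]^o)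
    (fun z : R[i]^o => Num.conj (z : R[i]) : R[i]^o)); first exact: Uc.
  exact: conjc.
pose F : 'M[tensor E]_n := \matrix_(i, j) \sum_k \sum_l
  fscale (cc k i l j) (tensor_cst (x k l)).
have FE t : tensor_mxev t F = mxcongr (U (sval t)) x.
  apply/matrixP => i j; rewrite !mxE linear_sum; apply: eq_bigr => k _.
  by rewrite linear_sum; apply: eq_bigr => l _.
exists F; last by split; rewrite FE.
apply/Hset_pathP; split.
  by apply: tensor_mx_inj => t; rewrite tensor_mxev_star FE mxstar_congr sx.
move=> s /bx[g g0 gP]; exists g => // t H phi ucp pure max.
rewrite FE shifted_congr //; apply: modulus_congr; first by case: ucp.
  exact: unitarymx_block.
exact: gP.
Qed.

(** A self-adjoint unitary [v] has eigenvalues 1 and -1; letting the latter run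
    through [w u = exp (i pi u)] joins the identity to [v] by unitaries, which
    are combinations [p + q v] with [p + q = 1] and [p - q = w]. *)
Lemma joined_reflection n (v : 'M[R[i]]_n) (x : 'M[E]_n) :
  adjmx v = v -> v *m v = 1%:M -> Hset delta x -> joined delta x (mxcongr v x).
Proof.
move=> av vv Hx.
pose w (u : R) : R[i] := (cos (pi * u))%:C + 'i%C * (sin (pi * u))%:C.
have trig_cont (f : R -> R) : continuous f -> continuous (fun u : R => (f (pi * u))%:C : R[i]^o).
  move=> fc u; apply: (@continuous_comp _ _ _ (fun u => f (pi * u)) (fun v : R => v%:C : R[i]^o)).
    apply: (@continuous_comp _ _ _ (fun u => pi * u) f); last exact: fc.
    by apply: continuousM; [exact: cst_continuous|exact: cvg_id].
  exact: continuous_realC.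
have wc : continuous (w : R -> R[i]^o).
  apply: continuous_addC; first exact: trig_cont (@continuous_cos R).
  apply: continuous_mulC; first exact: continuous_cstC.
  exact: trig_cont (@continuous_sin R).
have ww u : Num.conj (w u) * w u = 1.
  rewrite /w rmorphD rmorphM /= conjci !conjcR mulNr -subr_sqr exprMn sqr_i.
  by rewrite mulN1r opprK -!rmorphXn -rmorphD /= cos2Dsin2.
pose p u := (1 + w u) / 2; pose q u := (1 - w u) / 2.
pose U u : 'M[R[i]]_n := (p u)%:M + q u *: v.
have UU u : adjmx (U u) *m U u = 1%:M.
  have c2 : Num.conj (2 : R[i])^-1 = 2^-1 by rewrite fmorphV /= rmorph_nat.
  have -> : adjmx (U u) = (Num.conj (p u))%:M + Num.conj (q u) *: v.
    rewrite /adjmx /U raddfD /= map_mxD tr_scalar_mx map_scalar_mx linearZ /= map_mxZ.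
    by rewrite -[map_mx _ v^T]/(adjmx v) av.
  rewrite mulmxDl !mulmxDr -!scalemxAl -!scalemxAr vv -scalar_mxM mul_scalar_mx mul_mx_scalar.
  rewrite !scalerA scalemx1 [X in _ + X]addrC addrACA -raddfD -scalerDl /=.
  have -> : q u * Num.conj (p u) + Num.conj (q u) * p u = 0.
    rewrite /p /q !rmorphM rmorphB rmorphD /= rmorph1 c2.
    transitivity ((1 - Num.conj (w u) * w u) / 2); last by rewrite ww subrr mul0r.
    by field.
  have -> : Num.conj (p u) * p u + Num.conj (q u) * q u = 1.
    rewrite /p /q !rmorphM rmorphB rmorphD /= rmorph1 c2.
    transitivity ((1 + Num.conj (w u) * w u) / 2); last by rewrite ww; field.
    by field.
  by rewrite scale0r addr0.
have w0 : w 0 = 1 by rewrite /w mulr0 cos0 sin0 rmorph0 rmorph1 mulr0 addr0.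
have w1 : w 1 = -1 by rewrite /w mulr1 cospi sinpi rmorph0 mulr0 addr0 rmorphN1.
have U0 : U 0 = 1%:M.
  by rewrite /U /p /q w0 subrr mul0r scale0r addr0 divff ?pnatr_eq0.
have U1 : U 1 = v.
  by rewrite /U /p /q w1 subrr mul0r raddf0 add0r opprK divff ?pnatr_eq0 // scale1r.
have := @joined_unitary_path n U x; rewrite U0 U1.
rewrite mxcongr1.
apply; [|by move=> u; split; [exact: UU|exact: mulmx1C (UU u)]|exact: Hx].
move=> k i; rewrite (_ : (fun _ => _) = fun u => p u * (k == i)%:R + q u * v k i); last first.
  by apply/funext => z; rewrite /U !mxE mulr_natr.
have pqc c : continuous (fun u => (1 + c * w u) / 2 : R[i]^o).
  apply: continuous_mulC; last exact: continuous_cstC.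
  apply: continuous_addC; first exact: continuous_cstC.
  by apply: continuous_mulC; [exact: continuous_cstC|exact: wc].
have pE : p = fun u => (1 + 1 * w u) / 2 by apply/funext => u; rewrite mul1r.
have qE : q = fun u => (1 + -1 * w u) / 2 by apply/funext => u; rewrite mulN1r.
apply: continuous_addC; apply: continuous_mulC.
- by rewrite pE; exact: pqc.
- exact: continuous_cstC.
- by rewrite qE; exact: pqc.
- exact: continuous_cstC.
Qed.

Lemma joined_tperm n (a b : 'I_n) (x : 'M[E]_n) : Hset delta x ->
  joined delta x (mxsub (tperm a b) (tperm a b) x).
Proof.
move=> Hx; rewrite -mxcongr_pmx.
have adj : adjmx (pmx (tperm a b)) = pmx (tperm a b) :> 'M[R[i]]_n.
  apply/matrixP => i j; rewrite !mxE rmorph_nat; congr (_%:R).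
  by rewrite -(can_eq (tpermK a b)) tpermK eq_sym.
apply: joined_reflection => //.
have [] : unitarymx (pmx (tperm a b) : 'M[R[i]]_n).
  by apply: pmx_unitary; exists (tperm a b); exact: tpermK.
by rewrite adj.
Qed.

(** Permutation matrices are products of transpositions, which are
    reflections. *)
Lemma joined_mxsub n (f : 'I_n -> 'I_n) (x : 'M[E]_n) : injective f ->
  Hset delta x -> joined delta x (mxsub f f x).
Proof.
move=> fI Hx; have -> : mxsub f f x = mxsub (perm fI) (perm fI) x.
  by apply/matrixP => i j; rewrite !mxE !permE.
have [ts -> _] := prod_tpermP (perm fI).
elim: ts => [|t ts IH].
  rewrite big_nil; have -> : mxsub (1 : 'S_n)%g (1 : 'S_n)%g x = x.
    by apply/matrixP => i j; rewrite !mxE !perm1.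
  exact: joined_refl.
rewrite big_cons; set s' := (\prod_(t <- ts) _)%g in IH *.
apply: (joined_trans IH).
have -> : mxsub (tperm t.1 t.2 * s')%g (tperm t.1 t.2 * s')%g x =
    mxsub (tperm t.1 t.2) (tperm t.1 t.2) (mxsub s' s' x).
  by apply/matrixP => i j; rewrite !mxE !permM.
by apply: joined_tperm; have [] := joined_Hset IH.
Qed.

End UnitaryPaths.
(** * Stable homotopy *)

Section StableHomotopy.
Context {R : realType} {E : opsys R}.
Variable delta : R.
Hypotheses (delta_ge0 : 0 <= delta) (delta_le1 : delta <= 1).

Notation unitmx n := ((ounit E)%:M : 'M[E]_n).

Lemma stabilizeE n a k (p : (n + a)%N = k) (le_nk : (n <= k)%N) (x : 'M[E]_n) :
  stabilize le_nk x = castmx (p, p) (dsum x (unitmx a)).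
Proof.
case: k / p le_nk => le_nk; rewrite /stabilize.
by move: (subnKC le_nk); rewrite addKn => q; rewrite !castmx_id.
Qed.

Lemma dsumA n m l (x : 'M[E]_n) (y : 'M[E]_m) (z : 'M[E]_l) :
  dsum (dsum x y) z = castmx (addnA n m l, addnA n m l) (dsum x (dsum y z)).
Proof.
have /= := block_mxAx x 0 0 0 y 0 0 0 z; rewrite /dsum !row_mx0 !col_mx0 => ->.
by rewrite castmx_comp castmx_id.
Qed.

Lemma stabilize_id n (le_nn : (n <= n)%N) (x : 'M[E]_n) : stabilize le_nn x = x.
Proof.
rewrite (stabilizeE (addn0 n)); apply/matrixP => i j; rewrite castmxE /=.
have shift k : cast_ord (esym (addn0 n)) k = lshift 0 k by exact: val_inj.
by rewrite !shift block_mxEul.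
Qed.

Lemma stabilize_comp n m k (le_nm : (n <= m)%N) (le_mk : (m <= k)%N)
    (le_nk : (n <= k)%N) (x : 'M[E]_n) :
  stabilize le_mk (stabilize le_nm x) = stabilize le_nk x.
Proof.
move: (subnKC le_nm) (subnKC le_mk); move: (m - n)%N (k - m)%N => a b p q.
case: k / q le_mk le_nk; case: m / p le_nm => le_nm le_mk le_nk.
rewrite (stabilizeE erefl le_mk) (stabilizeE erefl le_nm) !castmx_id dsumA.
rewrite (stabilizeE (addnA n a b)); congr (castmx _ (dsum _ _)).
by rewrite [RHS]scalar_mx_block.
Qed.

Lemma Hset_stabilize n m (le_nm : (n <= m)%N) (x : 'M[E]_n) :
  Hset delta x -> Hset delta (stabilize le_nm x).
Proof.
move=> Hx; move: (subnKC le_nm); move: (m - n)%N => a p.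
case: m / p le_nm => le_nm; rewrite (stabilizeE erefl) castmx_id.
by apply: Hset_dsum => //; exact: Hset_unit.
Qed.

Lemma joined_stabilize n m (le_nm : (n <= m)%N) (x y : 'M[E]_n) :
  joined delta x y -> joined delta (stabilize le_nm x) (stabilize le_nm y).
Proof.
move=> xy; move: (subnKC le_nm); move: (m - n)%N => a p.
case: m / p le_nm => le_nm; rewrite !(stabilizeE erefl) !castmx_id.
by apply: joined_dsum => //; apply: joined_refl; exact: Hset_unit.
Qed.

Definition stably_joined n m (x : 'M[E]_n) (y : 'M[E]_m) : Prop :=
  exists k (le_nk : (n <= k)%N) (le_mk : (m <= k)%N),
    joined delta (stabilize le_nk x) (stabilize le_mk y).

Lemma stably_homotopicP (X Y : Hcoprod E delta) : stably_homotopic X Y <->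
  stably_joined (sval (tagged X)) (sval (tagged Y)).
Proof.
split=> [[k [le [le' [y [y' [e e' /homotopicP yy]]]]]]|[k [le [le' xy]]]].
  by exists k, le, le'; rewrite -e -e'.
have [H1 H2] := joined_Hset xy.
exists k, le, le', (exist _ _ H1), (exist _ _ H2); split=> //.
exact/homotopicP.
Qed.

Lemma joined_stably n (x y : 'M[E]_n) : joined delta x y -> stably_joined x y.
Proof. by exists n, (leqnn n), (leqnn n); rewrite !stabilize_id. Qed.

Lemma stably_joined_refl n (x : 'M[E]_n) : Hset delta x -> stably_joined x x.
Proof. by move=> Hx; apply: joined_stably; exact: joined_refl. Qed.

Lemma stably_joined_sym n m (x : 'M[E]_n) (y : 'M[E]_m) : stably_joined x y -> stably_joined y x.
Proof. by move=> [k [le [le' xy]]]; exists k, le', le; exact: joined_sym. Qed.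

(** Both homotopies are stabilized to the size [k1 + k2]. *)
Lemma stably_joined_trans n m l (x : 'M[E]_n) (y : 'M[E]_m) (z : 'M[E]_l) :
  stably_joined x y -> stably_joined y z -> stably_joined x z.
Proof.
move=> [k1 [le1 [le1' xy]]] [k2 [le2 [le2' yz]]].
have l1 : (k1 <= k1 + k2)%N := leq_addr _ _.
have l2 : (k2 <= k1 + k2)%N := leq_addl _ _.
exists (k1 + k2)%N, (leq_trans le1 l1), (leq_trans le2' l2).
have := joined_stabilize l1 xy; have := joined_stabilize l2 yz.
rewrite (stabilize_comp le1 l1 (leq_trans le1 l1)).
rewrite (stabilize_comp le1' l1 (leq_trans le1' l1)).
rewrite (stabilize_comp le2 l2 (leq_trans le1' l1)).
rewrite (stabilize_comp le2' l2 (leq_trans le2' l2)).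
by move=> yz' xy'; exact: joined_trans xy' yz'.
Qed.

Lemma stably_joined_stabilize n m (le_nm : (n <= m)%N) (x : 'M[E]_n) :
  Hset delta x -> stably_joined x (stabilize le_nm x).
Proof.
move=> Hx; exists m, le_nm, (leqnn m); rewrite stabilize_id.
by apply: joined_refl; exact: Hset_stabilize.
Qed.

Lemma stably_joined_unit n a (x : 'M[E]_n) :
  Hset delta x -> stably_joined x (dsum x (unitmx a)).
Proof.
move=> Hx; have := stably_joined_stabilize (leq_addr a n) Hx.
by rewrite (stabilizeE erefl) castmx_id.
Qed.

(** A bijection of index sets forces the two sizes to agree, so this is
    [joined_mxsub] up to a change of type. *)
Lemma stably_joined_mxsub n m (f : 'I_m -> 'I_n) (x : 'M[E]_n) : bijective f ->
  Hset delta x -> stably_joined x (mxsub f f x).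
Proof.
move=> fb Hx; have mn : m = n by have := bij_eq_card fb; rewrite !card_ord.
case: n / mn f x fb Hx => f x fb Hx; apply: joined_stably.
by apply: joined_mxsub => //; exact: bij_inj.
Qed.

Definition swap n m (k : 'I_(n + m)) : 'I_(m + n) :=
  match fintype.split k with inl i => rshift m i | inr j => lshift n j end.

Lemma swap_l n m i : @swap n m (lshift m i) = rshift m i.
Proof. by rewrite /swap (unsplitK (inl i)). Qed.

Lemma swap_r n m j : @swap n m (rshift n j) = lshift n j.
Proof. by rewrite /swap (unsplitK (inr j)). Qed.

Lemma swap_bij n m : bijective (@swap n m).
Proof.
by exists (@swap m n) => k; case: (split_ordP k) => i ->; rewrite ?swap_l ?swap_r ?swap_l.
Qed.

Lemma stably_joined_dsumC n m (x : 'M[E]_n) (y : 'M[E]_m) :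
  Hset delta x -> Hset delta y -> stably_joined (dsum x y) (dsum y x).
Proof.
move=> Hx Hy; have -> : dsum y x = mxsub (@swap m n) (@swap m n) (dsum x y).
  apply/matrixP => i j; rewrite [RHS]mxE.
  case: (split_ordP i) => i' ->; case: (split_ordP j) => j' ->;
  by rewrite ?swap_l ?swap_r /dsum ?(block_mxEul, block_mxEur, block_mxEdl, block_mxEdr)
    ?[LHS]mxE ?[RHS]mxE.
by apply: stably_joined_mxsub; [exact: swap_bij|exact: Hset_dsum].
Qed.

Lemma stably_joined_dsumA n m l (x : 'M[E]_n) (y : 'M[E]_m) (z : 'M[E]_l) :
  Hset delta x -> Hset delta y -> Hset delta z ->
  stably_joined (dsum x (dsum y z)) (dsum (dsum x y) z).
Proof.
move=> Hx Hy Hz; rewrite dsumA castmxEsub; apply: stably_joined_mxsub.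
  by exists (cast_ord (addnA n m l)); [exact: cast_ordKV|exact: cast_ordK].
by apply: Hset_dsum => //; exact: Hset_dsum.
Qed.

(** Commute [y] to the front, stabilize there, and commute it back. *)
Lemma stably_joined_unit_inside n a m (x : 'M[E]_n) (y : 'M[E]_m) :
  Hset delta x -> Hset delta y -> stably_joined (dsum x y) (dsum (dsum x (unitmx a)) y).
Proof.
move=> Hx Hy; have Hu := Hset_unit (E := E) a delta_ge0 delta_le1.
apply: stably_joined_trans (stably_joined_dsumC Hx Hy) _.
apply: stably_joined_trans (stably_joined_unit a (Hset_dsum Hy Hx)) _.
apply: stably_joined_trans (stably_joined_sym (stably_joined_dsumA Hy Hx Hu)) _.
by apply: stably_joined_dsumC => //; exact: Hset_dsum.
Qed.

(** Insert the units needed to stabilize [x] and [x'] before [y]; at that stage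
    the summands are homotopic. *)
Lemma stably_joined_dsuml n n' m (x : 'M[E]_n) (x' : 'M[E]_n') (y : 'M[E]_m) :
  Hset delta x -> Hset delta x' -> Hset delta y ->
  stably_joined x x' -> stably_joined (dsum x y) (dsum x' y).
Proof.
move=> Hx Hx' Hy [k [le [le' xx']]].
have pad l (z : 'M[E]_l) (le_lk : (l <= k)%N) : Hset delta z ->
    stably_joined (dsum z y) (dsum (stabilize le_lk z) y).
  move=> Hz {le le' xx'}; move: (subnKC le_lk); move: (k - l)%N => a p.
  case: k / p le_lk => le_lk; rewrite (stabilizeE erefl) castmx_id.
  exact: stably_joined_unit_inside.
apply: stably_joined_trans (pad _ _ le Hx) _.
apply: stably_joined_trans (stably_joined_sym (pad _ _ le' Hx')).
by apply: joined_stably; apply: joined_dsum => //; exact: joined_refl.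
Qed.

Lemma stably_joined_dsum n n' m m' (x : 'M[E]_n) (x' : 'M[E]_n')
    (y : 'M[E]_m) (y' : 'M[E]_m') :
  Hset delta x -> Hset delta x' -> Hset delta y -> Hset delta y' ->
  stably_joined x x' -> stably_joined y y' -> stably_joined (dsum x y) (dsum x' y').
Proof.
move=> Hx Hx' Hy Hy' xx' yy'.
apply: stably_joined_trans (stably_joined_dsuml Hx Hx' Hy xx') _.
apply: stably_joined_trans (stably_joined_dsumC Hx' Hy) _.
apply: stably_joined_trans (stably_joined_dsuml Hy Hy' Hx' yy') _.
exact: stably_joined_dsumC.
Qed.

End StableHomotopy.
(** * Classes, direct limit and semigroup structure *)

Section QuotientTheory.
Context {T : Type} {r : T -> T -> Prop}.
Hypothesis req : Equivalence r.

Lemma class_ofP x y : class_of r x = class_of r y <-> r x y.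
Proof.
have [rr rs rt] := req; split=> [xy|xy].
  have : [set z | r x z] y; last by [].
  by have -> : [set z | r x z] = [set z | r y z] := congr1 sval xy; exact: rr.
apply: eq_exist; apply/seteqP; split=> z /= h.
  exact: rt (rs _ _ xy) h.
exact: rt xy h.
Qed.

Lemma quot_surj (c : quot r) : exists x, class_of r x = c.
Proof.
case: c => A [x Ax]; exists x; exact: eq_exist.
Qed.

Definition repr_of (c : quot r) : T := projT1 (cid (quot_surj c)).

Lemma repr_ofK c : class_of r (repr_of c) = c.
Proof. exact: projT2 (cid (quot_surj c)). Qed.

Lemma repr_of_class x : r (repr_of (class_of r x)) x.
Proof. by apply/class_ofP; rewrite repr_ofK. Qed.

End QuotientTheory.

Section Classes.
Context {R : realType} {E : opsys R} {delta : R}.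
Hypotheses (delta_ge0 : 0 <= delta) (delta_le1 : delta <= 1).

Lemma homotopic_equiv n : Equivalence (@homotopic R E delta n).
Proof.
split=> [x|x y|x y z].
- by apply/homotopicP; apply: joined_refl; exact: (svalP x).
- by move=> /homotopicP xy; apply/homotopicP; exact: joined_sym.
- by move=> /homotopicP xy /homotopicP yz; apply/homotopicP; exact: joined_trans xy yz.
Qed.

Lemma stably_homotopic_equiv : Equivalence (@stably_homotopic R E delta).
Proof.
split=> [x|x y|x y z].
- by apply/stably_homotopicP; apply: stably_joined_refl; exact: (svalP (tagged x)).
- by move=> /stably_homotopicP xy; apply/stably_homotopicP; exact: stably_joined_sym.
- move=> /stably_homotopicP xy /stably_homotopicP yz; apply/stably_homotopicP.
  exact: stably_joined_trans xy yz.
Qed.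

Lemma V0n_classP n (x y : Hdelta E delta n) :
  V0n_class x = V0n_class y <-> joined delta (sval x) (sval y).
Proof.
rewrite -homotopicP; exact: (class_ofP (homotopic_equiv n)).
Qed.

Lemma V0_classP (n m : psize) (x : Hdelta E delta n) (y : Hdelta E delta m) :
  V0_class n x = V0_class m y <-> stably_joined delta (sval x) (sval y).
Proof.
apply: iff_trans (class_ofP stably_homotopic_equiv _ _) _.
exact: stably_homotopicP.
Qed.

Lemma V0n_ind n (P : V0n E delta n -> Prop) :
  (forall x, P (V0n_class x)) -> forall c, P c.
Proof. by move=> Px c; have [x <-] := quot_surj c; exact: Px. Qed.

Lemma V0_ind (P : V0 E delta -> Prop) :
  (forall (n : psize) x, P (V0_class n x)) -> forall c, P c.
Proof. by move=> Px c; have [[n x] <-] := quot_surj c; exact: Px. Qed.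

Definition stabH n m (le_nm : (n <= m)%N) (x : Hdelta E delta n) : Hdelta E delta m :=
  exist _ (stabilize le_nm (sval x))
    (Hset_stabilize delta_ge0 delta_le1 le_nm (svalP x)).

Definition dsumH n m (x : Hdelta E delta n) (y : Hdelta E delta m) :
    Hdelta E delta (n + m)%N :=
  exist _ (dsum (sval x) (sval y)) (Hset_dsum (svalP x) (svalP y)).

Definition unitH n : Hdelta E delta n :=
  exist _ (ounit E)%:M (Hset_unit n delta_ge0 delta_le1).

Definition connecting (n m : psize) (le_nm : (n <= m)%N) (c : V0n E delta n) :
    V0n E delta m :=
  V0n_class (stabH le_nm (repr_of c)).

Definition to_limit (n : psize) (c : V0n E delta n) : V0 E delta :=
  V0_class n (repr_of c).

Definition class_add (a b : V0 E delta) : V0 E delta :=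
  V0_class (psize_add (tag (repr_of a)) (tag (repr_of b)))
    (dsumH (tagged (repr_of a)) (tagged (repr_of b))).

Lemma connecting_class (n m : psize) (le_nm : (n <= m)%N) (x : Hdelta E delta n) :
  connecting le_nm (V0n_class x) = V0n_class (stabH le_nm x).
Proof.
apply/V0n_classP; apply: joined_stabilize => //; apply/homotopicP.
exact: (repr_of_class (homotopic_equiv n)).
Qed.

Lemma to_limit_class (n : psize) (x : Hdelta E delta n) :
  to_limit (V0n_class x) = V0_class n x.
Proof.
apply/V0_classP; apply: joined_stably; apply/homotopicP.
exact: (repr_of_class (homotopic_equiv n)).
Qed.

Lemma class_add_class (n m : psize) (x : Hdelta E delta n) (y : Hdelta E delta m) :
  class_add (V0_class n x) (V0_class m y) = V0_class (psize_add n m) (dsumH x y).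
Proof.
apply/V0_classP; apply: stably_joined_dsum => //; try exact: svalP.
  by apply/(@stably_homotopicP R E delta _ (existT _ n x)); exact: (repr_of_class stably_homotopic_equiv).
by apply/(@stably_homotopicP R E delta _ (existT _ m y)); exact: (repr_of_class stably_homotopic_equiv).
Qed.

Lemma connecting_direct_system : direct_system connecting.
Proof.
split=> [n le_nn|n m p le_nm le_mp le_np].
  elim/V0n_ind => x; rewrite connecting_class; apply/V0n_classP.
  by rewrite /= stabilize_id; apply: joined_refl; exact: (svalP x).
elim/V0n_ind => x; rewrite !connecting_class; apply/V0n_classP.
rewrite /= (stabilize_comp _ _ le_np); apply: joined_refl.
by apply: Hset_stabilize => //; exact: (svalP x).
Qed.

Lemma to_limit_compatible : compatible connecting to_limit.
Proof.
move=> n m le_nm; elim/V0n_ind => x; rewrite connecting_class !to_limit_class.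
apply/V0_classP; apply: stably_joined_sym; apply: stably_joined_stabilize => //.
exact: (svalP x).
Qed.

(** Stably homotopic elements become homotopic at a common stage, where a
    compatible family cannot tell them apart. *)
Lemma compatible_stable (Z : Type) (g : forall n : psize, V0n E delta n -> Z) :
  compatible connecting g ->
  forall (n m : psize) (x : Hdelta E delta n) (y : Hdelta E delta m),
  stably_joined delta (sval x) (sval y) -> g n (V0n_class x) = g m (V0n_class y).
Proof.
move=> gc n m x y [k [le [le' xy]]].
pose kp : psize := exist _ k (leq_trans (svalP n) le).
rewrite -(gc n kp le) -(gc m kp le') !connecting_class.
by congr (g kp _); apply/V0n_classP.
Qed.

Lemma to_limit_direct_limit : direct_limit connecting to_limit.
Proof.
split; first exact: to_limit_compatible.
move=> Z g gc; exists (fun c : V0 E delta => g (tag (repr_of c)) (V0n_class (tagged (repr_of c)))).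
split=> [n|u uP].
  elim/V0n_ind => x; rewrite to_limit_class; apply: compatible_stable gc _ _ _ _ _.
  by apply/(@stably_homotopicP R E delta _ (existT _ n x)); exact: (repr_of_class stably_homotopic_equiv).
apply/funext; elim/V0_ind => n x; rewrite -[in RHS]to_limit_class uP.
apply: compatible_stable gc _ _ _ _ _.
by apply/(@stably_homotopicP R E delta _ (existT _ n x)); exact: (repr_of_class stably_homotopic_equiv).
Qed.

Lemma class_addA : associative class_add.
Proof.
elim/V0_ind => n x; elim/V0_ind => m y; elim/V0_ind => l z.
rewrite !class_add_class; apply/V0_classP; apply: stably_joined_dsumA; exact: svalP.
Qed.

Lemma class_addC : commutative class_add.
Proof.
elim/V0_ind => n x; elim/V0_ind => m y.
rewrite !class_add_class; apply/V0_classP; apply: stably_joined_dsumC => //; exact: svalP.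
Qed.

Lemma class_addr0 : right_id (V0_class psize1 (unitH 1)) class_add.
Proof.
elim/V0_ind => n x; rewrite class_add_class; apply/V0_classP.
by apply: stably_joined_sym; apply: stably_joined_unit => //; exact: svalP.
Qed.

Lemma class_add0r : left_id (V0_class psize1 (unitH 1)) class_add.
Proof. by move=> c; rewrite class_addC class_addr0. Qed.

End Classes.

Theorem proposition8 (R : realType) (E : opsys R) (delta : R)
    (delta_ge0 : 0 <= delta) (delta_le1 : delta <= 1) :
  [/\ forall n : psize, Equivalence (@homotopic R E delta n),
      Equivalence (@stably_homotopic R E delta),
      exists (iota : forall n m : psize, (n <= m)%N ->
                V0n E delta n -> V0n E delta m)
             (j : forall n : psize, V0n E delta n -> V0 E delta),
        [/\ forall (n m : psize) (le_nm : (n <= m)%N) (x : Hdelta E delta n),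
              exists y : Hdelta E delta m,
                sval y = stabilize le_nm (sval x) /\
                iota n m le_nm (V0n_class x) = V0n_class y,
            forall (n : psize) (x : Hdelta E delta n),
              j n (V0n_class x) = V0_class n x,
            direct_system iota &
            direct_limit iota j] &
      exists (add : V0 E delta -> V0 E delta -> V0 E delta) (zero : V0 E delta),
        [/\ forall (n m : psize) (x : Hdelta E delta n) (y : Hdelta E delta m),
              exists z : Hdelta E delta (psize_add n m),
                sval z = dsum (sval x) (sval y) /\
                add (V0_class n x) (V0_class m y) =
                  V0_class (psize_add n m) z,
            exists e : Hdelta E delta psize1,
              sval e = (ounit E)%:M /\ zero = V0_class psize1 e,
            associative add,
            left_id zero add &
            right_id zero add]].

Proof.
split.
- by move=> n; exact: homotopic_equiv.
- exact: stably_homotopic_equiv.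
- exists (connecting delta_ge0 delta_le1), (@to_limit R E delta); split.
  + move=> n m le_nm x; exists (stabH delta_ge0 delta_le1 le_nm x).
    by rewrite connecting_class.
  + exact: to_limit_class.
  + exact: connecting_direct_system.
  + exact: to_limit_direct_limit.
- exists (@class_add R E delta), (V0_class psize1 (unitH delta_ge0 delta_le1 1)); split.
  + by move=> n m x y; exists (dsumH x y); rewrite class_add_class.
  + by exists (unitH delta_ge0 delta_le1 1).
  + exact: class_addA.
  + exact: class_add0r.
  + exact: class_addr0.
Qed.
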